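(* Let $X_1,X_2,\ldots$ be i.i.d. random variables having the exponential distribution with density $\lambda e^{-\lambda x}$, $x\ge 0$, for some $\lambda>0$ (the null hypothesis). Let $I_n=\int_0^\infty (H_n(t)-G_n(t))\,dF_n(t)$ be the integral statistic built from $X_1,\ldots,X_n$. Then, as $n\to\infty$, $$\sqrt{n}\,I_n \stackrel{d}{\longrightarrow} \mathcal{N}\Bigl(0,\tfrac{23}{10920}\Bigr),$$ where $\mathcal N(0,\sigma^2)$ is the centered normal law with variance $\sigma^2$.
   Context: For observations $X_1,\ldots,X_n$ define, for $t\ge 0$: $F_n(t)=n^{-1}\sum_{i=1}^n \mathbf 1\{X_i<t\}$ (empirical distribution function); $H_n(t)=\frac{1}{n^3}\sum_{i_1,i_2,i_3=1}^n \mathbf 1\{\max(X_{i_1},X_{i_2},X_{i_3})<t\}$; $G_n(t)=\frac{1}{3n^3}\sum_{i_1,i_2,i_3=1}^n\bigl[\mathbf 1\{\max(X_{i_1},X_{i_2})+\tfrac{X_{i_3}}{3}<t\}+\mathbf 1\{\max(X_{i_2},X_{i_3})+\tfrac{X_{i_1}}{3}<t\}+\mathbf 1\{\max(X_{i_3},X_{i_1})+\tfrac{X_{i_2}}{3}<t\}\bigr]$. The integral with respect to $dF_n$ is integration against the empirical measure, i.e. $I_n=\frac1n\sum_{i=1}^n (H_n(X_i)-G_n(X_i))$. *)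

(* Defs.v *)
From HB Require Import structures.
From mathcomp Require Import all_boot all_order all_algebra.
From mathcomp Require Import all_classical all_reals all_analysis.
From mathcomp Require Import measurable_realfun.
Set Implicit Arguments.
Unset Strict Implicit.
Unset Printing Implicit Defensive.
Import Order.TTheory GRing.Theory Num.Theory.
Import numFieldNormedType.Exports.
Local Open Scope classical_set_scope.
Local Open Scope ring_scope.

Section statistics.
Context {R : realType}.
Implicit Types (x : nat -> R) (n : nat) (t : R).

(* The observations X_1, ..., X_n are x 0, ..., x n.-1. *)

Definition Fn x n t : R := n%:R^-1 * \sum_(i < n) (x i < t)%R%:R.

Definition Hn x n t : R :=
  (n%:R ^+ 3)^-1 * \sum_(i < n) \sum_(j < n) \sum_(k < n)
    (Num.max (Num.max (x i) (x j)) (x k) < t)%R%:R.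

Definition Gn x n t : R :=
  (3%:R * n%:R ^+ 3)^-1 * \sum_(i < n) \sum_(j < n) \sum_(k < n)
    ((Num.max (x i) (x j) + x k / 3%:R < t)%R%:R
     + (Num.max (x j) (x k) + x i / 3%:R < t)%R%:R
     + (Num.max (x k) (x i) + x j / 3%:R < t)%R%:R).

(* The measure dF_n. *)
Definition empirical x n : set R -> \bar R :=
  mscale (n%:R^-1)%:nng (msum (fun i => \d_(x i)) n).

HB.instance Definition _ x n := Measure.on (empirical x n).

Definition Istat x n : R :=
  \int[empirical x n]_(t in `[0, +oo[) (Hn x n t - Gn x n t).

Lemma empiricalE x n (A : set R) :
  empirical x n A = (n%:R^-1 * \sum_(i < n) \1_A (x i))%:E.
Proof.
rewrite /empirical /mscale /msum/= EFinM -sumEFin.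
by congr (_ * _)%E; apply: eq_bigr => i _; rewrite diracE indicE.
Qed.

Lemma empirical_ray x n t : empirical x n `]-oo, t[ = (Fn x n t)%:E.
Proof.
rewrite empiricalE /Fn; congr ((_ * _)%:E).
apply: eq_bigr => i _; rewrite indicE; congr (_ %:R); congr (nat_of_bool _).
by apply/idP/idP; rewrite inE/= in_itv.
Qed.

Lemma ge0_integral_empirical x n (D : set R) (f : R -> R) : measurable D ->
  (forall t, D t -> 0 <= f t) -> measurable_fun D f ->
  (\int[empirical x n]_(t in D) (f t)%:E)%E =
  (n%:R^-1 * \sum_(i < n) \1_D (x i) * f (x i))%:E.
Proof.
move=> mD f0 mf.
have mF : measurable_fun D (EFin \o f) by exact/measurable_EFinP.
rewrite ge0_integral_mscale//= ge0_integral_measure_sum//.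
rewrite EFinM -sumEFin; congr (_ * _)%E.
by apply: eq_bigr => i _; rewrite integral_dirac.
Qed.

Lemma Rintegral_empirical x n (D : set R) (f : R -> R) : measurable D ->
  measurable_fun D f ->
  \int[empirical x n]_(t in D) f t =
  n%:R^-1 * \sum_(i < n) \1_D (x i) * f (x i).
Proof.
move=> mD mf; rewrite /Rintegral integralE.
have -> : ((fun t => (f t)%:E)^\+)%E = (fun t => (f^\+ t)%:E).
  by apply/funext => t; rewrite funeposE /funrpos EFin_max.
have -> : ((fun t => (f t)%:E)^\-)%E = (fun t => (f^\- t)%:E).
  by apply/funext => t; rewrite funenegE /funrneg EFin_max.
rewrite !ge0_integral_empirical//.
- rewrite -EFinB/= -mulrBr -sumrB; congr (_ * _).
  apply: eq_bigr => i _; rewrite -mulrBr; congr (_ * _).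
  by rewrite -[in RHS](funrposBneg f).
- exact/measurable_funrneg.
- exact/measurable_funrpos.
Qed.

Lemma measurable_lt_ind d (T : measurableType d) (f g : T -> R) :
  measurable_fun setT f -> measurable_fun setT g ->
  measurable_fun setT (fun w => (f w < g w)%R%:R : R).
Proof.
move=> mf mg.
by apply: (@measurableT_comp _ _ _ _ _ _ (fun b : bool => b%:R : R)) => //;
  exact: measurable_fun_ltr.
Qed.

Lemma measurable_Hn d (T : measurableType d) (X : nat -> T -> R) (t : T -> R) n :
  (forall i, measurable_fun setT (X i)) -> measurable_fun setT t ->
  measurable_fun setT (fun w => Hn (X ^~ w) n (t w)).
Proof.
move=> mX mt; apply: measurable_funM => //.
do 3 (apply: measurable_sum => ?).
by apply: measurable_lt_ind => //; do 2 (apply: measurable_maxr => //).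
Qed.

Lemma measurable_Gn d (T : measurableType d) (X : nat -> T -> R) (t : T -> R) n :
  (forall i, measurable_fun setT (X i)) -> measurable_fun setT t ->
  measurable_fun setT (fun w => Gn (X ^~ w) n (t w)).
Proof.
move=> mX mt; apply: measurable_funM => //.
do 3 (apply: measurable_sum => ?).
by apply: measurable_funD; first apply: measurable_funD;
  apply: measurable_lt_ind => //; apply: measurable_funD;
  do ?[exact: measurable_maxr|exact: measurable_funM].
Qed.

Lemma Istat_sumE x n :
  Istat x n = n%:R^-1 * \sum_(i < n)
    \1_(`[0, +oo[%classic : set R) (x i) * (Hn x n (x i) - Gn x n (x i)).
Proof.
rewrite /Istat Rintegral_empirical//; apply: measurable_funTS.
apply: measurable_funB.
  apply: (@measurable_Hn _ R (fun i => cst (x i)) idfun) => [i|].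
    exact: measurable_cst.
  exact: measurable_id.
apply: (@measurable_Gn _ R (fun i => cst (x i)) idfun) => [i|].
  exact: measurable_cst.
exact: measurable_id.
Qed.

Lemma Istat_sum_ge0E x n : (forall i, (i < n)%N -> 0 <= x i) ->
  Istat x n = n%:R^-1 * \sum_(i < n) (Hn x n (x i) - Gn x n (x i)).
Proof.
move=> x0; rewrite Istat_sumE; congr (_ * _); apply: eq_bigr => i _.
by rewrite indicE mem_set ?mul1r//= in_itv/= x0.
Qed.

End statistics.

Section random.
Context d (T : measurableType d) (R : realType) (P : probability T R).

(* Mutual independence: the product rule over every finite subfamily. *)
Definition independent_RVs (X : nat -> {RV P >-> R}) : Prop :=
  forall (J : seq nat) (B : nat -> set R), uniq J ->
    (forall i, measurable (B i)) ->
    P (\bigcap_(i in [set` J]) (X i @^-1` B i)) =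
    (\prod_(i <- J) P (X i @^-1` B i))%E.

(* Two laws are compared on measurable sets only: library measures also take
   unspecified values on non-measurable sets. *)
Definition has_law (Y : {RV P >-> R}) (mu : set R -> \bar R) : Prop :=
  forall B, measurable B -> distribution P Y B = mu B.

(* Convergence in distribution: the distribution functions converge at every
   continuity point of the limiting one. *)
Definition cvg_in_law (Y : nat -> {RV P >-> R}) (mu : probability (measurableTypeR R) R) : Prop :=
  forall r : R, {for r, continuous (fun s : R => mu `]-oo, s]%classic)} ->
    cdf (Y n) r @[n --> \oo] --> mu `]-oo, r]%classic.

Definition sqrtn_Istat (X : nat -> {RV P >-> R}) (n : nat) (w : T) : R :=
  Num.sqrt n%:R * Istat (fun i => X i w) n.

Lemma measurable_sqrtn_Istat (X : nat -> {RV P >-> R}) n :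
  measurable_fun setT (sqrtn_Istat X n).
Proof.
apply: measurable_funM => //.
under eq_fun do rewrite Istat_sumE.
apply: measurable_funM => //; apply: measurable_sum => i.
apply: measurable_funM; first by apply: measurableT_comp.
apply: measurable_funB.
  by apply: (@measurable_Hn _ _ _ (fun i => X i)).
by apply: (@measurable_Gn _ _ _ (fun i => X i)).
Qed.

HB.instance Definition _ X n :=
  isMeasurableFun.Build _ _ _ _ (sqrtn_Istat X n) (measurable_sqrtn_Istat X n).

End random.

Arguments independent_RVs {d T R} P X.
Arguments has_law {d T R} P Y mu.
Arguments cvg_in_law {d T R} P Y mu.

(* Main.v *)
(** With V_i = exp(- lambda X_i / 3) in (0, 1], the event X_i + X_k / 3 < X_l reads
  V_l^3 < V_i^3 V_k, so [Istat] is the proportion of quadruples whose last entry is the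
  strict minimum, which is 1/4 up to ties, minus the average over (k, l) of the squared
  proportion U_kl of the i with V_l^3 < V_i^3 V_k. Writing F(c, e) for the conditional
  probability (1 - e^3 / c)^+, the square U^2 = (U - F)^2 + 2 F (U - F) + F^2 splits the
  second term into its linear (Hajek) part and averages of kernels that integrate to zero
  in each of two of their arguments; the second moment of such an average is O(n^-2),
  because only the index tuples with coincidences contribute. Hence [Istat] is, up to
  O(1/n) in mean, the average of the i.i.d. bounded centred variables [projection] (V_i),
  whose moments E V^k = 3 / (k + 3) give the variance 23/10920.

  The central limit theorem follows from Lindeberg's replacement argument on bounded
  functions with a cubic Taylor estimate; cubic splines between indicators of half-lines
  turn this into convergence of distribution functions. *)

Require Import Defs.
From mathcomp Require Import all_boot all_order all_algebra.
From mathcomp Require Import all_classical all_reals all_analysis.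
From mathcomp Require Import measurable_realfun zify ring lra.
Set Implicit Arguments.
Unset Strict Implicit.
Unset Printing Implicit Defensive.
Import Order.TTheory GRing.Theory Num.Theory.
Import numFieldNormedType.Exports.
Local Open Scope classical_set_scope.
Local Open Scope ring_scope.

(** * Expectations of bounded measurable functions *)

Section bounded_measurable.
Context d (T : measurableType d) (R : realType).
Implicit Types f g : T -> R.

(** Dividing by 3 in G_n becomes a cube root: for the variables V_i, X_k / 3 is one factor V_k and
    X_i is V_i^3, and V_i^3 is uniform on (0, 1). The conditional expectations that enter the linear
    part are then polynomials, c / 3, (1 - e^3)^3 and c (a^3 - a^6 / 2); the first two have mean
    1/4, which is what cancels the constant 1/4 of the H_n term. So H_n only centres the statistic,
    and the whole variance comes from G_n. All averages run over coinciding indices too. These are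
    not split off: the second-moment bound counts them together with the other coincidences.
    Independence is given on finite intersections of events only, while one variable has to be
    integrated out with all the others frozen. The others are therefore kept as a sigma-algebra on
    the same space rather than as a tuple. The normal variables of the replacement argument are
    never constructed either: they act as averaging operators on test functions. *)

Definition bmeas f := measurable_fun setT f /\ exists M, forall x, `|f x| <= M.

Lemma bmeasP f M : measurable_fun setT f -> (forall x, `|f x| <= M) -> bmeas f.
Proof. by move=> mf fM; split=> //; exists M. Qed.

Lemma bmeas_cst r : bmeas (fun=> r).
Proof. by apply: (@bmeasP _ `|r|) => //; exact: measurable_cst. Qed.

Lemma bmeasD f g : bmeas f -> bmeas g -> bmeas (fun x => f x + g x).
Proof.
move=> [mf [M fM]] [mg [N gN]]; apply: (@bmeasP _ (M + N)).
  exact: measurable_funD.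
by move=> x; apply: le_trans (ler_normD _ _) _; exact: lerD.
Qed.

Lemma bmeasM f g : bmeas f -> bmeas g -> bmeas (fun x => f x * g x).
Proof.
move=> [mf [M fM]] [mg [N gN]]; apply: (@bmeasP _ (M * N)).
  exact: measurable_funM.
by move=> x; rewrite normrM; exact: ler_pM.
Qed.

Lemma bmeasZ r f : bmeas f -> bmeas (fun x => r * f x).
Proof. by apply: bmeasM; exact: bmeas_cst. Qed.

Lemma bmeasN f : bmeas f -> bmeas (fun x => - f x).
Proof. by move=> /(bmeasZ (-1)); under eq_fun do rewrite mulN1r. Qed.

Lemma bmeasB f g : bmeas f -> bmeas g -> bmeas (fun x => f x - g x).
Proof. by move=> bf bg; apply: bmeasD => //; exact: bmeasN. Qed.

Lemma bmeasX f n : bmeas f -> bmeas (fun x => f x ^+ n).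
Proof.
move=> bf; elim: n => [|n IH]; first exact: bmeas_cst.
by under eq_fun do rewrite exprS; exact: bmeasM.
Qed.

Lemma bmeas_sum (I : Type) (s : seq I) (f : I -> T -> R) :
  (forall i, bmeas (f i)) -> bmeas (fun x => \sum_(i <- s) f i x).
Proof.
move=> bf; elim: s => [|i s IH].
  by under eq_fun do rewrite big_nil; exact: bmeas_cst.
by under eq_fun do rewrite big_cons; exact: bmeasD.
Qed.

Lemma bmeas_norm f : bmeas f -> bmeas (fun x => `|f x|).
Proof.
move=> [mf [M fM]]; apply: (@bmeasP _ M); first exact: measurableT_comp.
by move=> x; rewrite normr_id.
Qed.

Lemma bmeas_lt (f g : T -> R) : measurable_fun setT f -> measurable_fun setT g ->
  bmeas (fun x => (f x < g x)%R%:R).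
Proof.
move=> mf mg; apply: (@bmeasP _ 1); last first.
  by move=> x; case: (_ < _); rewrite ?normr1 ?normr0.
exact: measurable_lt_ind.
Qed.

End bounded_measurable.

Lemma bmeas_comp d d' (T : measurableType d) (T' : measurableType d') (R : realType)
  (f : T' -> R) (g : T -> T') : bmeas f -> measurable_fun setT g ->
  bmeas (fun x => f (g x)).
Proof.
move=> [mf [M fM]] mg; apply: (@bmeasP _ _ _ _ M) => //.
exact: measurableT_comp.
Qed.

Section expectation.
Context d (T : measurableType d) (R : realType) (P : probability T R).
Implicit Types f g : T -> R.

Lemma bmeas_integrable f : bmeas f -> P.-integrable setT (EFin \o f).
Proof.
move=> [mf [M fM]]; apply: measurable_bounded_integrable => //.
  exact: le_lt_trans (probability_le1 P measurableT) (ltry _).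
exists M; split; first exact: num_real.
by move=> N MN x _ /=; apply: le_trans (fM x) (ltW MN).
Qed.

Lemma mean_cst r : \int[P]_x r = r.
Proof. by rewrite Rintegral_cst//; have /= -> := @probability_setT _ _ _ P; rewrite mulr1. Qed.

Lemma meanD f g : bmeas f -> bmeas g ->
  \int[P]_x (f x + g x) = \int[P]_x f x + \int[P]_x g x.
Proof. by move=> bf bg; apply: RintegralD => //; exact: bmeas_integrable. Qed.

Lemma meanB f g : bmeas f -> bmeas g ->
  \int[P]_x (f x - g x) = \int[P]_x f x - \int[P]_x g x.
Proof. by move=> bf bg; apply: RintegralB => //; exact: bmeas_integrable. Qed.

Lemma meanZ r f : bmeas f -> \int[P]_x (r * f x) = r * \int[P]_x f x.
Proof. by move=> bf; apply: RintegralZl => //; exact: bmeas_integrable. Qed.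

Lemma mean_sum (I : Type) (s : seq I) (f : I -> T -> R) :
  (forall i, bmeas (f i)) ->
  \int[P]_x (\sum_(i <- s) f i x) = \sum_(i <- s) \int[P]_x f i x.
Proof.
move=> bf; elim: s => [|i s IH].
  by under eq_Rintegral do rewrite big_nil; rewrite mean_cst big_nil.
under eq_Rintegral do rewrite big_cons.
by rewrite meanD// ?IH ?big_cons//; exact: bmeas_sum.
Qed.

Lemma le_mean f g : bmeas f -> bmeas g -> (forall x, f x <= g x) ->
  \int[P]_x f x <= \int[P]_x g x.
Proof.
by move=> bf bg fg; apply: le_Rintegral => //; exact: bmeas_integrable.
Qed.

Lemma norm_mean f : bmeas f -> `|\int[P]_x f x| <= \int[P]_x `|f x|.
Proof. by move=> bf; apply: le_normr_Rintegral => //; exact: bmeas_integrable. Qed.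

Lemma norm_mean_le f M : bmeas f -> (forall x, `|f x| <= M) ->
  `|\int[P]_x f x| <= M.
Proof.
move=> bf fM; apply: le_trans (norm_mean bf) _.
rewrite -[leRHS]mean_cst; apply: le_mean => //.
  exact: bmeas_norm.
exact: bmeas_cst.
Qed.

End expectation.

(** * Product measures and independent pairs *)

Section product_measures.
Context d1 d2 (T1 : measurableType d1) (T2 : measurableType d2) (R : realType).
Variables (f : T1 * T2 -> R) (bf : bmeas f).

Lemma bmeas_section1 y : bmeas (fun x => f (x, y)).
Proof. by apply: (bmeas_comp bf); exact: measurable_fun_pair. Qed.

Lemma bmeas_section2 x : bmeas (fun y => f (x, y)).
Proof. by apply: (bmeas_comp bf); exact: measurable_fun_pair. Qed.

Let integrable_f (P : probability T1 R) (Q : probability T2 R) :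
  (P \x Q)%E.-integrable setT (EFin \o f).
Proof. exact: bmeas_integrable. Qed.

Lemma bmeas_mean2 (Q : probability T2 R) : bmeas (fun x => \int[Q]_y f (x, y)).
Proof.
have [mf [M fM]] := bf.
apply: (@bmeasP _ _ _ _ M); last first.
  by move=> x; apply: norm_mean_le => // ; exact: bmeas_section2.
(* The Dirac mass is an arbitrary first factor: the section integral does not involve it. *)
have mF := measurable_fubini_F (integrable_f \d_point Q).
exact: (measurableT_comp (f := fine)).
Qed.

Lemma bmeas_mean1 (P : probability T1 R) : bmeas (fun y => \int[P]_x f (x, y)).
Proof.
have [mf [M fM]] := bf.
apply: (@bmeasP _ _ _ _ M); last first.
  by move=> x; apply: norm_mean_le => // ; exact: bmeas_section1.
have mG := measurable_fubini_G (integrable_f P \d_point).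
exact: (measurableT_comp (f := fine)).
Qed.

Variables (P : probability T1 R) (Q : probability T2 R).

Lemma mean_prod2 : \int[(P \x Q)%E]_z f z = \int[Q]_y \int[P]_x f (x, y).
Proof.
rewrite {1}/Rintegral -(integral21_prod_meas1 (integrable_f P Q)); congr fine.
apply: eq_integral => y _; rewrite fineK//.
by apply: integrable_fin_num => //; apply: bmeas_integrable; exact: bmeas_section1.
Qed.

End product_measures.

Lemma mean_distribution d d' (T : measurableType d) (T' : measurableType d')
  (R : realType) (P : probability T R) (X : {mfun T >-> T'}) (f : T' -> R) :
  bmeas f -> \int[distribution P X]_y f y = \int[P]_x f (X x).
Proof.
move=> bf; rewrite {1}/Rintegral integral_pushforward//; first exact/measurable_EFinP/bf.1.
by apply: (bmeas_integrable _ (bmeas_comp bf _)).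
Qed.

(** The product rule on rectangles determines the joint law as the product of the marginals, and
    Fubini does the rest. The target types are arbitrary so that Y may be the identity of T into a
    coarser sigma-algebra. *)
Lemma mean_indep d d1 d2 (T : measurableType d) (T1 : measurableType d1)
    (T2 : measurableType d2) (R : realType) (P : probability T R)
    (V : T -> T1) (Y : T -> T2) (f : T1 * T2 -> R) :
  measurable_fun setT V -> measurable_fun setT Y ->
  (forall B C, measurable B -> measurable C ->
    P (V @^-1` B `&` Y @^-1` C) = (P (V @^-1` B) * P (Y @^-1` C))%E) ->
  bmeas f ->
  \int[P]_w f (V w, Y w) = \int[P]_w \int[P]_w' f (V w', Y w).
Proof.
move=> mV mY VY bf; pose V' : {mfun T >-> T1} := mfun_Sub (mem_set mV).
pose Y' : {mfun T >-> T2} := mfun_Sub (mem_set mY).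
have mZ : measurable_fun setT (fun w => (V w, Y w)) by exact: measurable_fun_pair.
pose Z : {mfun T >-> (T1 * T2)%type} := mfun_Sub (mem_set mZ).
transitivity (\int[distribution P Z]_z f z); first by rewrite mean_distribution.
transitivity (\int[(distribution P V' \x distribution P Y')%E]_z f z).
  congr fine; apply: eq_measure_integral => A mA _; apply/esym.
  apply: product_measure_unique => // B C mB mC; exact: VY.
rewrite mean_prod2// mean_distribution; last exact: bmeas_mean1.
apply: eq_Rintegral => w _; rewrite mean_distribution//.
exact: bmeas_section1.
Qed.

(** * Integrating out one variable of an independent family *)

Section independent_family.
Context d (T : measurableType d) (R : realType) (P : probability T R).
Variable V : nat -> T -> R.
Hypothesis mV : forall i, measurable_fun setT (V i).
Hypothesis indepV : forall (J : seq nat) (B : nat -> set R), uniq J ->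
  (forall i, measurable (B i)) ->
  P (\bigcap_(i in [set` J]) (V i @^-1` B i)) =
  (\prod_(i <- J) P (V i @^-1` B i))%E.

Let mpre i (B : set R) : measurable B -> measurable (V i @^-1` B).
Proof. by move=> mB; rewrite -[X in measurable X]setTI; exact: mV. Qed.

(* The generators of the sigma-algebra of all the V j with j != i. *)
Definition rest_gen (i : nat) : set (set T) :=
  [set A | exists (J : seq nat) (B : nat -> set R), [/\ uniq J, i \notin J,
     (forall j, measurable (B j)) &
     A = \bigcap_(j in [set` J]) (V j @^-1` B j)]].

Let rest_gen_measurable i : rest_gen i `<=` measurable.
Proof.
move=> _ [J [B [_ _ mB ->]]]; apply: bigcap_measurableType => j _; exact: mpre.
Qed.

Let rest_gen_setI i : setI_closed (rest_gen i).
Proof.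
move=> _ _ [J1 [B1 [_ iJ1 mB1 ->]]] [J2 [B2 [_ iJ2 mB2 ->]]].
exists (undup (J1 ++ J2)), (fun j => (if j \in J1 then B1 j else setT) `&`
                             (if j \in J2 then B2 j else setT)); split.
- exact: undup_uniq.
- by rewrite mem_undup mem_cat negb_or iJ1.
- by move=> j; apply: measurableI; case: ifP.
- apply/seteqP; split=> [w [w1 w2] j /= jJ|w wJ].
    by split; case: ifP => // jJi; [exact: w1|exact: w2].
  split=> j /= jJ; have /= := wJ j; rewrite mem_undup mem_cat jJ ?orbT => /(_ isT)[].
    by [].
  by [].
Qed.

(** For fixed B both sides are finite measures in A, and they agree on the generators, which are
    closed under intersection; uniqueness of measures extends this to the generated
    sigma-algebra. *)
Lemma indep_rest i (B : set R) (A : set T) : measurable B -> <<s rest_gen i >> A ->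
  P (V i @^-1` B `&` A) = (P (V i @^-1` B) * P A)%E.
Proof.
move=> mB sA; have mVB := mpre i mB.
have PVB : P (V i @^-1` B) \is a fin_num by exact: fin_num_measure.
pose r : {nonneg R} := NngNum (fine_ge0 (measure_ge0 P (V i @^-1` B))).
have [gT gm] : rest_gen i setT /\ rest_gen i `<=` measurable.
  split=> //; exists [::], (fun=> setT); split=> //.
  by rewrite set_nil bigcap_set0.
transitivity (mrestr P mVB A); first by rewrite /mrestr setIC.
transitivity (mscale r P A); last by rewrite /mscale/=; congr (_ * _)%E; exact: fineK.
apply: (@g_sigma_algebra_measure_unique _ _ _ (rest_gen i) _ (fun=> setT)) => //.
- by rewrite bigcup_const.
- move=> _ [J [C [uJ iJ mC ->]]]; rewrite /mrestr.
  set A' := bigcap _ _; transitivity (P (V i @^-1` B) * P A')%E; last first.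
    by apply/esym; rewrite /= /mscale; congr (_ * _)%E; exact: fineK.
  rewrite /A' [X in (_ * X)%E]indepV//= /mrestr setIC.
  (* [D] glues B at i to C elsewhere, so that one application of the product rule to i :: J covers
     both events. *)
  pose D j := if j == i then B else C j.
  have DC j : j \in J -> D j = C j.
    by rewrite /D; case: eqVneq => // ->; rewrite (negPf iJ).
  transitivity (P (\bigcap_(j in [set` i :: J]) (V j @^-1` D j))).
    congr (P _); apply/seteqP; split=> [w [wB wJ] j /=|w wJ].
      rewrite inE => /orP[/eqP ->|jJ]; first by rewrite /D eqxx.
      by rewrite DC//; exact: wJ.
    split; first by have := wJ i; rewrite /= inE eqxx /D eqxx; exact.
    by move=> j /= jJ; rewrite -DC//; apply: wJ; rewrite /= inE jJ orbT.
  rewrite indepV/= ?iJ//; last by move=> j; rewrite /D; case: ifP.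
  rewrite big_cons {1}/D eqxx; congr (_ * _)%E.
  by apply: eq_big_seq => j jJ; rewrite DC.
- move=> _; apply: (@le_lt_trans _ _ 1%E); last exact: ltry.
  by apply: probability_le1; exact: measurableI.
Qed.

(** The points are those of T, only the sigma-algebra shrinks: being measurable on this type says
    that a function of w depends on the V j with j != i alone. *)
Definition rest_type (i : nat) := g_sigma_algebraType (rest_gen i).

Lemma measurable_rest i j : j != i ->
  measurable_fun (setT : set (rest_type i)) (V j : rest_type i -> R).
Proof.
move=> ji _ B mB; rewrite setTI; apply: sub_sigma_algebra.
exists [:: j], (fun=> B); split=> //; first by rewrite inE eq_sym.
by apply/seteqP; split=> [w wB k /=|w]; [rewrite inE => /eqP ->|apply; rewrite /= inE].
Qed.

(** This is [mean_indep] with the identity map into [rest_type i] as second variable; all the other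
    variables are frozen at w in the inner integral. *)
Lemma mean_rest i (f : R * rest_type i -> R) : bmeas f ->
  \int[P]_w f (V i w, w) = \int[P]_w \int[P]_w' f (V i w', w).
Proof.
apply: (@mean_indep _ _ _ _ _ _ _ _ (V i) (id : T -> rest_type i)) => //.
  move=> _ A mA; rewrite setTI preimage_id.
  have : (@measurable _ T) A; last by [].
  apply: (smallest_sub (@sigma_algebra_measurable _ T) _ mA).
  exact: rest_gen_measurable.
by move=> B C mB mC; apply: indep_rest.
Qed.

End independent_family.

(** * Averages of canonical kernels *)

Lemma sqr_sum_le (R : realFieldType) n (a : 'I_n -> R) :
  (\sum_i a i) ^+ 2 <= n%:R * \sum_i a i ^+ 2.
Proof.
have h : 0 < 2%:R :> R by rewrite ltr0n.
rewrite -(ler_pM2l h) expr2 mulr_suml.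
under eq_bigr do rewrite mulr_sumr.
have -> : 2%:R * (n%:R * \sum_i a i ^+ 2) = \sum_i \sum_j (a i ^+ 2 + a j ^+ 2).
  under [RHS]eq_bigr do rewrite big_split/= sumr_const card_ord.
  by rewrite big_split/= sumr_const card_ord sumrMnl; ring.
rewrite mulr_sumr; apply: ler_sum => i _; rewrite mulr_sumr; apply: ler_sum => j _.
by rewrite -subr_ge0 (_ : _ - _ = (a i - a j)^+2) ?sqr_ge0//; ring.
Qed.

Section matches.
Local Open Scope nat_scope.
Variables (n : nat) (k l : 'I_n).

(* Vanishes only if one of i, j, i' differs from all the other five indices. *)
Definition matches (i j i' j' : 'I_n) : nat :=
  ((i == k) + (i == l) + (i == i') + (i == j')) *
  ((j == k) + (j == l) + (j == i') + (j == j')) +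
  (i == j) * ((i' == k) + (i' == l) + (i' == i) + (i' == j')).

Let sum_eq (a : 'I_n) : \sum_(i < n) (i == a : nat) = 1.
Proof.
by rewrite (bigD1 a)//= eqxx big1 ?addn0// => i /negPf ->.
Qed.

(** An equality with one fixed index sums to 1 over the free index. The first product thus gives 4 *
    4 for each pair (i', j'), hence 16 n^2; in the second term i = j removes one sum and the bracket
    gives 4, hence 4 n^2. *)
Lemma sum_matches :
  \sum_(i < n) \sum_(j < n) \sum_(i' < n) \sum_(j' < n) matches i j i' j' =
  20 * n ^ 2.
Proof.
pose A (i i' j' : 'I_n) := (i == k) + (i == l) + (i == i') + (i == j').
have sumA i' j' : \sum_(i < n) A i i' j' = 4 by rewrite !big_split/= !sum_eq.
under eq_bigr do under eq_bigr do under eq_bigr do rewrite big_split/=.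
under eq_bigr do under eq_bigr do rewrite big_split/=.
under eq_bigr do rewrite big_split/=.
rewrite big_split/=.
have -> : \sum_(i < n) \sum_(j < n) \sum_(i' < n) \sum_(j' < n)
    (A i i' j' * A j i' j')%N = 16 * n ^ 2.
  under eq_bigr do rewrite exchange_big/=; rewrite exchange_big/=.
  under eq_bigr do under eq_bigr do rewrite exchange_big/=.
  under eq_bigr do rewrite exchange_big/=.
  under eq_bigr => i' _ do under eq_bigr => j' _ do
    under eq_bigr => i _ do rewrite -big_distrr/= sumA.
  under eq_bigr => i' _ do under eq_bigr => j' _ do rewrite -big_distrl/= sumA.
  by rewrite !sum_nat_const !card_ord; lia.
have -> : \sum_(i < n) \sum_(j < n) \sum_(i' < n) \sum_(j' < n)
    ((i == j) * A i' i j')%N = 4 * n ^ 2.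
  under eq_bigr do under eq_bigr do rewrite exchange_big/=.
  under eq_bigr => i _ do under eq_bigr => j _ do under eq_bigr => j' _ do
    rewrite -big_distrr/= sumA.
  under eq_bigr => i _ do under eq_bigr => j _ do
    rewrite sum_nat_const card_ord eq_sym mulnCA.
  under eq_bigr => i _ do rewrite -big_distrl/= sum_eq.
  by rewrite sum_nat_const card_ord; lia.
lia.
Qed.

End matches.

Section canonical_kernel.
Context d (T : measurableType d) (R : realType) (P : probability T R).
Variable V : nat -> T -> R.
Hypothesis mV : forall i, measurable_fun setT (V i).
Hypothesis indepV : forall (J : seq nat) (B : nat -> set R), uniq J ->
  (forall i, measurable (B i)) ->
  P (\bigcap_(i in [set` J]) (V i @^-1` B i)) =
  (\prod_(i <- J) P (V i @^-1` B i))%E.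

Lemma bmeas_quad d' (T' : measurableType d') (g : R * R * R * R -> R)
    (a b c e : T' -> R) : bmeas g ->
  measurable_fun setT a -> measurable_fun setT b ->
  measurable_fun setT c -> measurable_fun setT e ->
  bmeas (fun w => g (a w, b w, c w, e w)).
Proof.
by move=> bg ma mb mc me; apply: (bmeas_comp bg); do 3 (apply: measurable_fun_pair => //).
Qed.

Let measurable_rest_snd i j : j != i ->
  measurable_fun (setT : set (R * rest_type V i)) (fun p => V j p.2).
Proof.
move=> ji.
apply: (@measurableT_comp _ _ _ _ _ _ (V j : rest_type V i -> R)).
  exact: measurable_rest.
exact: measurable_snd.
Qed.

Variables (D : set R) (VD : forall i w, D (V i w)).

(** Integrating out V i first leaves h as a constant factor. The set D is the range of the
    variables: the centring identities of the kernels are available only there. *)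
Let vanish1 (g : R * R * R * R -> R) i j k l (h : rest_type V i -> R) :
  bmeas g ->
  (forall y z t, D y -> D z -> D t -> \int[P]_w g (V i w, y, z, t) = 0) ->
  bmeas h -> j != i -> k != i -> l != i ->
  \int[P]_w (g (V i w, V j w, V k w, V l w) * h w) = 0.
Proof.
move=> bg g0 bh ji ki li.
pose f (p : R * rest_type V i) := g (p.1, V j p.2, V k p.2, V l p.2) * h p.2.
have bf : bmeas f.
  apply: bmeasM; last by apply: (bmeas_comp bh); exact: measurable_snd.
  by apply: bmeas_quad => //; exact: measurable_rest_snd.
rewrite (mean_rest mV indepV bf) -[RHS](mean_cst P); apply: eq_Rintegral => w _.
rewrite /f/=; under eq_Rintegral do rewrite mulrC.
rewrite meanZ; first by rewrite g0 ?mulr0.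
by apply: bmeas_quad.
Qed.

Variables (g : R * R * R * R -> R) (mg : measurable_fun setT g) (M : R).
Hypothesis gM : forall p, `|g p| <= M.
Hypothesis g1 : forall i y z t, D y -> D z -> D t ->
  \int[P]_w g (V i w, y, z, t) = 0.
Hypothesis g2 : forall i x z t, D x -> D z -> D t ->
  \int[P]_w g (x, V i w, z, t) = 0.

Let bg : bmeas g. Proof. exact: bmeasP gM. Qed.
Let G i j k l w := g (V i w, V j w, V k w, V l w).
Let bG i j k l : bmeas (G i j k l).
Proof. exact: bmeas_quad. Qed.
Let M0 : 0 <= M. Proof. exact: le_trans (normr_ge0 _) (gM (0, 0, 0, 0)). Qed.

Let bG_rest m i j k l : i != m -> j != m -> k != m -> l != m ->
  bmeas (fun w : rest_type V m => G i j k l w).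
Proof. by move=> im jm km lm; apply: bmeas_quad => //; exact: measurable_rest. Qed.

Let G1 i j k l i' j' : i \notin [:: j; k; l; i'; j'] ->
  \int[P]_w (G i j k l w * G i' j' k l w) = 0.
Proof.
rewrite !inE !negb_or => /and5P[ij ik il ii' ij'].
apply: (vanish1 (h := G i' j' k l)) => //; rewrite 1?eq_sym//.
  by move=> *; exact: g1.
by apply: bG_rest; rewrite eq_sym.
Qed.

Let G2 i j k l i' j' : j \notin [:: i; k; l; i'; j'] ->
  \int[P]_w (G i j k l w * G i' j' k l w) = 0.
Proof.
rewrite !inE !negb_or => /and5P[ji jk jl ji' jj'].
(* Exchanging the first two slots reduces centring in the second one to [vanish1]. *)
pose s (p : R * R * R * R) := (p.1.1.2, p.1.1.1, p.1.2, p.2).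
have bgs : bmeas (g \o s).
  by apply: (@bmeas_quad _ _ g (fun p : R * R * R * R => p.1.1.2)
    (fun p => p.1.1.1) (fun p => p.1.2) (fun p => p.2)) => //;
    do 2 ?apply: measurableT_comp.
apply: (vanish1 (g := g \o s) (h := G i' j' k l) bgs) => //; rewrite 1?eq_sym//.
  by move=> *; exact: g2.
by apply: bG_rest; rewrite eq_sym.
Qed.

Let G_matches n (k l i j i' j' : 'I_n) :
  \int[P]_w (G i j k l w * G i' j' k l w) <= M ^+ 2 *+ matches k l i j i' j'.
Proof.
case: (posnP (matches k l i j i' j')) => [m0|m1]; last first.
  apply: (@le_trans _ _ (M ^+ 2)); last first.
    by rewrite -[leLHS]mulr1n; apply: ler_wpMn2l => //; exact: sqr_ge0.
  rewrite -[leRHS](mean_cst P); apply: le_mean.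
  - exact: bmeasM.
  - exact: bmeas_cst.
  - move=> w; apply: le_trans (ler_norm _) _; rewrite normrM expr2.
    by rewrite ler_pM// /G.
rewrite m0 mulr0n le_eqVlt; apply/orP; left; apply/eqP.
move/eqP: m0; rewrite /matches addn_eq0 muln_eq0 !addn_eq0 !eqb0.
move=> /andP[+ ijm]; have [ij|ij] := eqVneq i j.
  (* When i = j neither index is isolated, and the second term of [matches] says that i' is; the two
     factors change roles. *)
  move=> _; move: ijm; rewrite ij eqxx mul1n !addn_eq0 !eqb0 => /andP[/andP[/andP[a b] c] e].
  under eq_Rintegral do rewrite mulrC.
  by apply: G1; rewrite !inE !negb_or; apply/and5P; split.
move=> /orP[/andP[/andP[/andP[a b] c] e]|/andP[/andP[/andP[a b] c] e]].
  by apply: G1; rewrite !inE !negb_or; apply/and5P; split.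
by apply: G2; rewrite !inE !negb_or; apply/and5P; split=> //; rewrite eq_sym.
Qed.

(** Cauchy-Schwarz over k and l comes before the expansion of the square, so that both factors of
    every product share k and l. For each pair (k, l) the n^4 products then contribute at most 20
    n^2 M^2, by [G_matches] and [sum_matches]. *)
Lemma canonical_second_moment n :
  \int[P]_w ((n%:R ^+ 4)^-1 *
    \sum_(k < n) \sum_(l < n) \sum_(i < n) \sum_(j < n)
      g (V i w, V j w, V k w, V l w)) ^+ 2 <= 20%:R * M ^+ 2 / n%:R ^+ 2.
Proof.
(* At n = 0 both sides are 0, since the inverse of 0 is 0. *)
have [->|n0] := posnP n.
  under eq_Rintegral do rewrite big_ord0 mulr0 expr0n/=.
  by rewrite mean_cst expr0n/= invr0 mulr0.
have nR : 0 < n%:R :> R by rewrite ltr0n.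
pose Y k l w := \sum_(i < n) \sum_(j < n) G i j k l w.
have bY k l : bmeas (Y k l) by apply: bmeas_sum => i; exact: bmeas_sum.
have EY (k l : 'I_n) : \int[P]_w Y k l w ^+ 2 <= 20%:R * n%:R ^+ 2 * M ^+ 2.
  have -> : \int[P]_w Y k l w ^+ 2 = \sum_(i < n) \sum_(j < n) \sum_(i' < n)
      \sum_(j' < n) \int[P]_w (G i j k l w * G i' j' k l w).
    transitivity (\int[P]_w \sum_(i < n) \sum_(j < n) \sum_(i' < n)
      \sum_(j' < n) (G i j k l w * G i' j' k l w)).
      apply: eq_Rintegral => w _; rewrite expr2 /Y mulr_suml.
      apply: eq_bigr => i _; rewrite mulr_suml; apply: eq_bigr => j _.
      by rewrite mulr_sumr; apply: eq_bigr => i' _; rewrite mulr_sumr.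
    have bGG i j i' j' : bmeas (fun w => G i j k l w * G i' j' k l w).
      exact: bmeasM.
    rewrite mean_sum => [|i]; last by do 3 (apply: bmeas_sum => ?).
    apply: eq_bigr => i _; rewrite mean_sum => [|j]; last by do 2 (apply: bmeas_sum => ?).
    apply: eq_bigr => j _; rewrite mean_sum => [|i']; last by apply: bmeas_sum.
    by apply: eq_bigr => i' _; rewrite mean_sum.
  apply: (@le_trans _ _ (\sum_(i < n) \sum_(j < n) \sum_(i' < n) \sum_(j' < n)
     M ^+ 2 *+ matches k l i j i' j')).
    by do 4 (apply: ler_sum => ? _).
  under eq_bigr do under eq_bigr do under eq_bigr do rewrite sumrMnr.
  under eq_bigr do under eq_bigr do rewrite sumrMnr.
  under eq_bigr do rewrite sumrMnr.
  by rewrite sumrMnr sum_matches -[leLHS]mulr_natl natrM natrX.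
have nV0 : 0 <= (n%:R ^+ 4)^-1 :> R by rewrite invr_ge0 exprn_ge0 // ltW.
apply: (@le_trans _ _ (\int[P]_w ((n%:R ^+ 4)^-1 ^+ 2 * (n%:R * (n%:R *
    \sum_(k < n) \sum_(l < n) Y k l w ^+ 2))))).
  apply: le_mean.
  - apply: bmeasX; apply: bmeasZ; do 4 (apply: bmeas_sum => ?); exact: bG.
  - do 3 apply: bmeasZ; do 2 (apply: bmeas_sum => ?); exact: bmeasX.
  move=> w; rewrite exprMn; apply: ler_wpM2l; first exact: sqr_ge0.
  apply: le_trans (sqr_sum_le _) _; apply: ler_wpM2l; first exact: ltW.
  rewrite mulr_sumr; apply: ler_sum => k _; exact: sqr_sum_le.
have bS : bmeas (fun w => \sum_(k < n) \sum_(l < n) Y k l w ^+ 2).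
  by do 2 (apply: bmeas_sum => ?); exact: bmeasX.
rewrite meanZ; last by do 2 apply: bmeasZ.
rewrite meanZ; last exact: bmeasZ.
rewrite meanZ//.
rewrite mean_sum => [|k]; last by apply: bmeas_sum => ?; exact: bmeasX.
apply: (@le_trans _ _ ((n%:R ^+ 4)^-1 ^+ 2 * (n%:R * (n%:R *
    (\sum_(k < n) \sum_(l < n) 20%:R * n%:R ^+ 2 * M ^+ 2))))).
  apply: ler_wpM2l; first exact: sqr_ge0.
  do 2 (apply: ler_wpM2l; first exact: ltW).
  apply: ler_sum => k _; rewrite mean_sum => [|l]; last exact: bmeasX.
  by apply: ler_sum => l _.
rewrite !sumr_const !card_ord -mulrnA -[X in _ * (_ * (_ * X))]mulr_natl natrM le_eqVlt.
apply/orP; left; apply/eqP; field; exact: lt0r_neq0.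
Qed.

End canonical_kernel.

(** * The normal law *)

Section density.
Context {R : realType}.
Local Notation mu := (@lebesgue_measure R).
Local Open Scope ereal_scope.

(** The Radon-Nikodym derivative of Q has the same integral as p over every measurable set, hence
    equals p almost everywhere, and its change of variables formula carries over to p. *)
Lemma ge0_integral_density (Q : probability (measurableTypeR R) R) (p : R -> R) :
  (forall x, (0 <= p x)%R) -> measurable_fun setT p ->
  (forall A, measurable A -> Q A = \int[mu]_(x in A) (p x)%:E) ->
  forall f : R -> \bar R, measurable_fun setT f -> (forall x, 0 <= f x) ->
  \int[Q]_x f x = \int[mu]_x (f x * (p x)%:E).
Proof.
move=> p0 mp Qp f mf f0.
have mEp : measurable_fun setT (EFin \o p) by exact/measurable_EFinP.
have Qmu : Q `<< mu.
  apply/null_content_dominatesP => A mA A0.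
  rewrite [LHS]Qp//; apply: null_set_integral => //.
  exact: measurable_funTS.
pose q := Radon_Nikodym_SigmaFinite.f Q mu.
have iq : mu.-integrable setT q by exact: Radon_Nikodym_SigmaFinite.f_integrable.
have mq := measurable_int _ iq.
have qp : ae_eq mu setT q (EFin \o p).
  apply: integral_ae_eq => // E _ mE.
  by rewrite -Radon_Nikodym_SigmaFinite.f_integral// -Qp.
rewrite -(Radon_Nikodym_SigmaFinite.change_of_variables Qmu)//.
apply: ae_eq_integral => //.
- exact: emeasurable_funM.
- exact: emeasurable_funM.
- exact: ae_eqe_mul2l.
Qed.

Lemma ge0_integral_oppr (f : R -> \bar R) : measurable_fun setT f ->
  (forall x, 0 <= f x) -> \int[mu]_x f (- x)%R = \int[mu]_x f x.
Proof.
move=> mf f0; transitivity (\int[pushforward mu (-%R : _ -> measurableTypeR R)]_x f x).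
  by rewrite ge0_integral_pushforward.
by apply: eq_measure_integral => A mA _; exact: lebesgue_measureN.
Qed.

Lemma ge0_integral_shift (f : R -> \bar R) (a : R) : measurable_fun setT f ->
  (forall x, 0 <= f x) -> \int[mu]_x f (a + x)%R = \int[mu]_x f x.
Proof.
move=> mf f0.
have ma : measurable_fun setT (fun x : R => (a + x)%R : measurableTypeR R).
  exact: measurable_funD.
transitivity (\int[pushforward mu (fun x : R => (a + x)%R : measurableTypeR R)]_x f x).
  by rewrite ge0_integral_pushforward.
apply: eq_measure_integral => A mA _.
apply/esym/lebesgue_measure_unique => //= _ [[b c]] _ <-.
rewrite /pushforward.
have -> : (fun x : R => (a + x)%R) @^-1` `]b, c]%classic = `]b - a, c - a]%classic%R.
  by apply/seteqP; split=> x /=; rewrite !in_itv/= => /andP[? ?]; apply/andP; split; lra.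
rewrite !lebesgue_measure_itv/= !lte_fin.
by rewrite ltrD2r; case: ifP => // _; rewrite -!EFinB; congr EFin; lra.
Qed.

End density.

Section gaussian.
Context {R : realType}.
Implicit Types s t a b x y z w : R.
Local Notation mu := (@lebesgue_measure R).
Local Notation N s := (normal_prob 0 s : probability (measurableTypeR R) R).
Local Notation pdf := (@normal_pdf R 0).

Lemma normal_peakE s : 0 < s -> normal_peak s = (Num.sqrt (pi *+ 2))^-1 / s.
Proof.
move=> s0; rewrite /normal_peak -mulrnAr sqrtrM ?sqr_ge0// sqrtr_sqr gtr0_norm//.
by rewrite invfM mulrC.
Qed.

Lemma normal_pdf0E s z : 0 < s ->
  pdf s z = (Num.sqrt (pi *+ 2))^-1 / s * expR (- (z ^+ 2) / (s ^+ 2 *+ 2)).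
Proof.
by move=> s0; rewrite normal_pdfE ?gt_eqF// normal_peakE// /normal_fun subr0.
Qed.

(** A factor exp (- c z^2) turns the density of N(0, s^2) into a multiple of that of N(0, t^2),
    where t^-2 = s^-2 + 2 c. The integral of such a factor is therefore t / s by normalisation
    alone, for negative c as well. *)
Lemma normal_pdf_rescale s t z : 0 < s -> 0 < t ->
  t / s * pdf t z = expR (- ((t ^- 2 - s ^- 2) / 2%:R * z ^+ 2)) * pdf s z.
Proof.
move=> s0 t0; rewrite !normal_pdf0E//.
set k := (Num.sqrt _)^-1.
have -> : - z ^+ 2 / (t ^+ 2 *+ 2) =
   - ((t ^- 2 - s ^- 2) / 2%:R * z ^+ 2) + (- z ^+ 2 / (s ^+ 2 *+ 2)).
  by field; rewrite !gt_eqF.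
by rewrite expRD; field; rewrite !gt_eqF.
Qed.

Lemma ge0_integral_normal s (f : R -> \bar R) : measurable_fun setT f ->
  (forall x, 0 <= f x)%E ->
  (\int[N s]_x f x = \int[mu]_x (f x * (pdf s x)%:E))%E.
Proof.
move=> mf f0; apply: ge0_integral_density => //.
- by move=> x; exact: normal_pdf_ge0.
- exact: measurable_normal_pdf.
Qed.

(** For u = |z| / s, exp (u^2 / 4) is the square of exp (u^2 / 8) >= 1 + u^2 / 8, and 32 times that
    square exceeds 8 u^2 + u^4 / 2 >= 4 u^3. *)
Let bound3 s z : 0 < s ->
  `|z| ^+ 3 <= s ^+ 3 * (1 + 32%:R * expR (z ^+ 2 / (4%:R * s ^+ 2))).
Proof.
move=> s0; have -> : z ^+ 2 / (4%:R * s ^+ 2) = (`|z| / s) ^+ 2 / 4%:R.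
  by rewrite expr_div_n real_normK ?num_real//; field; rewrite gt_eqF.
have -> : `|z| ^+ 3 = s ^+ 3 * (`|z| / s) ^+ 3 by field; rewrite gt_eqF.
apply: ler_wpM2l; first by rewrite exprn_ge0// ltW.
have : 0 <= `|z| / s by rewrite divr_ge0// ltW.
move: (`|z| / s) => u u0.
have h : 1 + u ^+ 2 / 8%:R <= expR (u ^+ 2 / 8%:R) by exact: expR_ge1Dx.
have -> : expR (u ^+ 2 / 4%:R) = expR (u ^+ 2 / 8%:R) ^+ 2.
  by rewrite -expRM_natl; congr expR; field.
have h2 : (1 + u ^+ 2 / 8%:R) ^+ 2 <= expR (u ^+ 2 / 8%:R) ^+ 2.
  rewrite ler_pXn2r ?nnegrE ?expR_ge0//.
  by rewrite addr_ge0// divr_ge0// sqr_ge0.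
have u2 := sqr_ge0 u; apply: (@le_trans _ _ (1 + 32%:R * (1 + u ^+ 2 / 8%:R) ^+ 2)).
  by nra.
by rewrite lerD2l ler_wpM2l.
Qed.

Lemma normal_third_moment s : 0 < s ->
  (\int[N s]_x (`|x| ^+ 3)%:E <= (s ^+ 3 * (1 + 32%:R * Num.sqrt 2%:R))%:E)%E.
Proof.
(* For this t the factor in [normal_pdf_rescale] is exp (z^2 / (4 s^2)), the one in [bound3], and
   its mean is t / s = sqrt 2. *)
move=> s0; pose t := Num.sqrt 2%:R * s.
have q0 : 0 < Num.sqrt 2%:R :> R by rewrite sqrtr_gt0.
have t0 : 0 < t by exact: mulr_gt0.
have mX : measurable_fun setT (fun x : R => `|x| ^+ 3).
  by apply: measurable_funX; exact: normr_measurable.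
rewrite ge0_integral_normal//; last exact/measurable_EFinP.
apply: (@le_trans _ _ (\int[mu]_x (s ^+ 3 * pdf s x +
    s ^+ 3 * (32%:R * Num.sqrt 2%:R) * pdf t x)%:E)%E).
  apply: ge0_le_integral => //.
  - move=> x _; rewrite -EFinM lee_fin mulr_ge0 ?exprn_ge0 ?normal_pdf_ge0//.
  - apply/measurable_EFinP; apply: measurable_funM => //.
    exact: measurable_normal_pdf.
  - apply/measurable_EFinP; apply: measurable_funD; apply: measurable_funM => //;
      exact: measurable_normal_pdf.
  move=> x _; rewrite -EFinM lee_fin.
  apply: le_trans (ler_wpM2r (normal_pdf_ge0 _ _ _) (bound3 x s0)) _.
  rewrite le_eqVlt; apply/orP; left; apply/eqP.
  have := normal_pdf_rescale x s0 t0.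
  have -> : - ((t ^- 2 - s ^- 2) / 2 * x ^+ 2) = x ^+ 2 / (4%:R * s ^+ 2).
    have q2 : Num.sqrt 2%:R ^+ 2 = 2%:R :> R by rewrite sqr_sqrtr.
    rewrite /t exprMn q2.
    by field; rewrite gt_eqF.
  have -> : t / s = Num.sqrt 2%:R by rewrite /t; field; rewrite gt_eqF.
  by move=> h; rewrite -(mulrA _ (32%:R * _)) -(mulrA 32%:R) h; ring.
have iN u : mu.-integrable setT (fun x => (pdf u x)%:E) by exact: integrable_normal_pdf.
rewrite (_ : (fun x => _) = (fun x => (s ^+ 3)%:E * (pdf s x)%:E +
   (s ^+ 3 * (32%:R * Num.sqrt 2%:R))%:E * (pdf t x)%:E)%E); last first.
  by apply/funext => x; rewrite -!EFinM -EFinD.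
rewrite integralD//; try exact: integrableZl.
by rewrite !integralZl// !integral_normal_pdf !mule1 -EFinD mulrDr mulr1.
Qed.

Lemma normal_integrable s (f : R -> R) M : 0 < s -> measurable_fun setT f ->
  (forall z, `|f z| <= M + `|z| ^+ 3) -> (N s).-integrable setT (EFin \o f).
Proof.
move=> s0 mf fM.
have M0 : 0 <= M by have := fM 0; rewrite normr0 expr0n/= addr0; exact: le_trans.
have mX : measurable_fun setT (fun x : R => `|x| ^+ 3).
  by apply: measurable_funX; exact: normr_measurable.
apply/integrableP; split; first exact/measurable_EFinP.
apply: (@le_lt_trans _ _ (\int[N s]_x (M%:E + (`|x| ^+ 3)%:E))%E).
  apply: ge0_le_integral => //.
  - by apply/measurable_EFinP; exact: measurableT_comp.
  - by apply/measurable_EFinP; exact: measurable_funD.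
  - by move=> x _; rewrite -EFinD lee_fin.
rewrite ge0_integralD//; last exact/measurable_EFinP.
rewrite integral_cst//= probability_setT mule1.
by apply: lte_add_pinfty; [exact: ltry|exact: le_lt_trans (normal_third_moment s0) (ltry _)].
Qed.

Lemma normal_integrableX s k : 0 < s -> (k <= 3)%N ->
  (N s).-integrable setT (EFin \o (fun z => z ^+ k)).
Proof.
move=> s0 k3; apply: (@normal_integrable _ _ 1) => //.
move=> z; rewrite normrX; have := normr_ge0 z; move: `|z| => u u0.
have [u1|u1] := lerP u 1.
  apply: (@le_trans _ _ 1); first exact: exprn_ile1.
  by rewrite lerDl exprn_ge0.
apply: (@le_trans _ _ (u ^+ 3)); first by apply: ler_weXn2l => //; exact: ltW.
by rewrite lerDr.
Qed.

Lemma normal_mean s : 0 < s -> \int[N s]_z z = 0.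
Proof.
move=> s0; have i1 := normal_integrableX s0 (isT : (1 <= 3)%N).
have m1 : measurable_fun setT (EFin : R -> \bar R) by exact/measurable_EFinP.
have sym (f : R -> \bar R) : measurable_fun setT f -> (forall x, 0 <= f x)%E ->
    (\int[N s]_x f (- x)%R = \int[N s]_x f x)%E.
  move=> mf f0; have mfN : measurable_fun setT (fun x => f (- x)).
    exact: measurableT_comp.
  rewrite !ge0_integral_normal// -(ge0_integral_oppr (f := fun x => f x * (pdf s x)%:E)%E).
  - by apply: eq_integral => x _; rewrite !normal_pdf0E// sqrrN.
  - apply: emeasurable_funM => //; apply/measurable_EFinP.
    exact: measurable_normal_pdf.
  - by move=> x; rewrite mule_ge0// lee_fin normal_pdf_ge0.
have -> : \int[N s]_z z = fine (\int[N s]_z (EFin z)) by [].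
rewrite integralE.
have -> : (\int[N s]_x (EFin^\- x) = \int[N s]_x (EFin^\+ x))%E.
  rewrite -[RHS]sym; last 2 first.
  - exact: measurable_funepos.
  - by move=> x; exact: funepos_ge0.
  by apply: eq_integral => x _; rewrite funenegE funeposE EFinN.
by rewrite subee//; apply: integrable_pos_fin_num.
Qed.

(* The inequality 1 - c z^2 <= exp (- c z^2), integrated against N(0, s^2), bounds the
   second moment E by 1 - c E <= t / s for every c = (t^-2 - s^-2) / 2; letting t tend to
   s from both sides gives E = s^2. *)
Lemma normal_variance s : 0 < s -> \int[N s]_z z ^+ 2 = s ^+ 2.
Proof.
move=> s0; have i2 := normal_integrableX s0 (isT : (2 <= 3)%N).
set E := Rintegral _ _ _.
have E0 : 0 <= E by apply: Rintegral_ge0 => z _; exact: sqr_ge0.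
have key t : 0 < t -> 1 - (t ^- 2 - s ^- 2) / 2%:R * E <= t / s.
  move=> t0; set c := _ / 2%:R; have ts : 0 <= t / s by rewrite divr_ge0// ltW.
  have mexp : measurable_fun setT (fun z => expR (- (c * z ^+ 2))).
    apply: measurableT_comp => //; apply: measurableT_comp => //.
    by apply: measurable_funM => //; exact: measurable_funX.
  have intexp : (\int[N s]_z (expR (- (c * z ^+ 2)))%:E = (t / s)%:E)%E.
    rewrite ge0_integral_normal//; last exact/measurable_EFinP.
    transitivity (\int[mu]_z ((t / s)%:E * (pdf t z)%:E))%E.
      apply: eq_integral => z _; rewrite -!EFinM; congr EFin.
      by rewrite normal_pdf_rescale.
    rewrite integralZl//; last exact: integrable_normal_pdf.
    by rewrite integral_normal_pdf mule1.
  have ie : (N s).-integrable setT (EFin \o (fun z => expR (- (c * z ^+ 2)))).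
    apply/integrableP; split; first exact/measurable_EFinP.
    under eq_integral do rewrite /= ger0_norm ?expR_ge0//.
    by rewrite /= intexp ltry.
  have ic : (N s).-integrable setT (EFin \o (fun z => c * z ^+ 2)).
    have -> : EFin \o (fun z : R => c * z ^+ 2) = (fun z => c%:E * (z ^+ 2)%:E)%E.
      exact/funext.
    exact: integrableZl.
  have il : (N s).-integrable setT (EFin \o (fun z => 1 - c * z ^+ 2)).
    have -> : EFin \o (fun z : R => 1 - c * z ^+ 2) =
        ((EFin \o cst 1%R) \- (EFin \o (fun z : R => c * z ^+ 2)%R))%E by apply/funext.
    by apply: integrableB => //; exact: finite_measure_integrable_cst.
  have <- : \int[N s]_z expR (- (c * z ^+ 2)) = t / s by rewrite /Rintegral intexp.
  have -> : 1 - c * E = \int[N s]_z (1 - c * z ^+ 2).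
    rewrite RintegralB//; last exact: finite_measure_integrable_cst.
    by rewrite mean_cst RintegralZl.
  by apply: le_Rintegral => // z _; exact: expR_ge1Dx.
(* Denominators are cleared and a factor s - t is kept on both sides: its sign decides whether E is
   bounded above or below. *)
have key2 t : 0 < t -> (s - t) * (2%:R * s * t ^+ 2) <= (s - t) * ((s + t) * E).
  move=> t0; have := key t t0.
  rewrite -(ler_pM2r (_ : 0 < 2%:R * s ^+ 2 * t ^+ 2)) ?mulr_gt0 ?exprn_gt0//.
  have -> : (1 - (t ^- 2 - s ^- 2) / 2 * E) * (2 * s ^+ 2 * t ^+ 2) =
     2 * s ^+ 2 * t ^+ 2 - (s - t) * ((s + t) * E) by field; rewrite !gt_eqF.
  have -> : t / s * (2 * s ^+ 2 * t ^+ 2) = 2%:R * s * t ^+ 3 by field; rewrite !gt_eqF.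
  by move=> h; nra.
have s2 : 0 < s ^+ 2 by rewrite exprn_gt0.
(* With t = s (1 + r) and t = s (1 - r) the bounds on E become s^2 (1 + r)^2 and s^2 (1 - r)^2, both
   within 3 s^2 r of s^2. *)
have delta e : 0 < e -> exists r, [/\ 0 < r, r < 1 & 3%:R * s ^+ 2 * r <= e].
  move=> e0; have d0 : 0 < e + 3%:R * s ^+ 2 by nra.
  exists (e / (e + 3%:R * s ^+ 2)); split; first exact: divr_gt0.
    by rewrite ltr_pdivrMr// mul1r; nra.
  by rewrite mulrA ler_pdivrMr//; nra.
apply/eqP; rewrite eq_le; apply/andP; split.
  apply/ler_addgt0Pr => e /delta[r [r0 r1 re]].
  have := key2 (s * (1 + r)) _.
  rewrite mulr_gt0 ?addr_gt0// => /(_ isT).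
  rewrite (_ : s - s * (1 + r) = - (s * r)); last by ring.
  rewrite !mulNr lerN2 ler_pM2l ?mulr_gt0//.
  rewrite (_ : 2 * s * _ = s * (2 * s ^+ 2 * (1 + r) ^+ 2)); last by ring.
  rewrite (_ : (s + _) * _ = s * ((2 + r) * E)); last by ring.
  rewrite ler_pM2l// => h.
  have : (2 + r) * E <= (2 + r) * (s ^+ 2 * (1 + r) ^+ 2).
    apply: le_trans h _; rewrite -subr_ge0.
    have -> : (2 + r) * (s ^+ 2 * (1 + r) ^+ 2) - 2 * s ^+ 2 * (1 + r) ^+ 2 =
      r * (s ^+ 2 * (1 + r) ^+ 2) by ring.
    by apply: mulr_ge0; [exact: ltW|apply: mulr_ge0; exact: sqr_ge0].
  rewrite ler_pM2l ?addr_gt0// => h2.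
  apply: le_trans h2 _.
  apply: le_trans (_ : s ^+ 2 + 3%:R * s ^+ 2 * r <= _); last by rewrite lerD2l.
  rewrite -subr_ge0 (_ : _ - _ = s ^+ 2 * (r * (1 - r))); last by ring.
  by apply: mulr_ge0; [exact: sqr_ge0|apply: mulr_ge0; rewrite ?subr_ge0; exact: ltW].
apply/ler_addgt0Pr => e /delta[r [r0 r1 re]].
have := key2 (s * (1 - r)) _.
rewrite mulr_gt0 ?subr_gt0// => /(_ isT).
rewrite (_ : s - s * (1 - r) = s * r); last by ring.
rewrite ler_pM2l ?mulr_gt0//.
rewrite (_ : 2 * s * _ = s * (2 * s ^+ 2 * (1 - r) ^+ 2)); last by ring.
rewrite (_ : (s + _) * _ = s * ((2 - r) * E)); last by ring.
rewrite ler_pM2l// => h.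
have : (2 - r) * (s ^+ 2 * (1 - r) ^+ 2) <= (2 - r) * E.
  apply: le_trans _ h; rewrite -subr_ge0.
  have -> : 2 * s ^+ 2 * (1 - r) ^+ 2 - (2 - r) * (s ^+ 2 * (1 - r) ^+ 2) =
    r * (s ^+ 2 * (1 - r) ^+ 2) by ring.
  by apply: mulr_ge0; [exact: ltW|apply: mulr_ge0; exact: sqr_ge0].
rewrite ler_pM2l; last by lra.
move=> h2; apply: le_trans (lerD h2 re).
rewrite -subr_ge0 (_ : _ - _ = s ^+ 2 * (r * (1 + r))); last by ring.
by apply: mulr_ge0; [exact: sqr_ge0|apply: mulr_ge0; lra].
Qed.

End gaussian.

(** * Convolution of centred normal laws *)

Section gaussian_convolution.
Context {R : realType}.
Implicit Types s t a b x y z w : R.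
Local Notation mu := (@lebesgue_measure R).
Local Notation N s := (normal_prob 0 s : probability (measurableTypeR R) R).
Local Notation pdf := (@normal_pdf R 0).

(** Completing the square in y: the joint density of a summand y and the sum w is the density of the
    sum times the conditional density of the summand, normal with mean a^2 w / c^2 and deviation a b
    / c. Integrating y out then leaves the density of the sum. *)
Lemma normal_pdf_conv a b c y w : 0 < a -> 0 < b -> 0 < c ->
  c ^+ 2 = a ^+ 2 + b ^+ 2 ->
  pdf b (w - y) * pdf a y =
  pdf c w * normal_pdf (a ^+ 2 * w / c ^+ 2) (a * b / c) y.
Proof.
move=> a0 b0 c0 cab; have abc0 : 0 < a * b / c by rewrite divr_gt0// mulr_gt0.
rewrite !normal_pdf0E// normal_pdfE ?gt_eqF// normal_peakE// /normal_fun.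
set k := (Num.sqrt _)^-1.
have cn : c != 0 by rewrite gt_eqF.
have an : a != 0 by rewrite gt_eqF.
have bn : b != 0 by rewrite gt_eqF.
have e : - (w - y) ^+ 2 / (b ^+ 2 *+ 2) + - y ^+ 2 / (a ^+ 2 *+ 2) =
  - w ^+ 2 / (c ^+ 2 *+ 2) +
  - (y - a ^+ 2 * w / c ^+ 2) ^+ 2 / ((a * b / c) ^+ 2 *+ 2).
  have c2 : c ^+ 2 != 0 by rewrite expf_neq0.
  have -> : - (y - a ^+ 2 * w / c ^+ 2) ^+ 2 / ((a * b / c) ^+ 2 *+ 2) =
     - (y * c ^+ 2 - a ^+ 2 * w) ^+ 2 / (c ^+ 2 * a ^+ 2 * b ^+ 2 *+ 2).
    by field; rewrite an bn cn.
  move: c2; rewrite cab => c2.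
  by field; rewrite c2 bn an.
rewrite [LHS]mulrACA [RHS]mulrACA -!expRD e; congr (_ * _).
by field; rewrite an bn cn.
Qed.

Lemma ge0_normal_conv a b c (h : R -> R) : 0 < a -> 0 < b -> 0 < c ->
  c ^+ 2 = a ^+ 2 + b ^+ 2 -> measurable_fun setT h -> (forall x, 0 <= h x) ->
  (\int[N a]_y \int[N b]_z (h (y + z))%:E = \int[N c]_w (h w)%:E)%E.
Proof.
move=> a0 b0 c0 cab mh h0.
have mpdf s : measurable_fun setT (fun x => (pdf s x)%:E).
  by apply/measurable_EFinP; exact: measurable_normal_pdf.
have inner y : (\int[N b]_z (h (y + z))%:E = \int[mu]_w (h w * pdf b (w - y))%:E)%E.
  rewrite ge0_integral_normal; last 2 first.
  - by apply/measurable_EFinP; apply: measurableT_comp => //; exact: measurable_funD.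
  - by move=> x; rewrite lee_fin.
  rewrite -[RHS](ge0_integral_shift y); last 2 first.
  - apply/measurable_EFinP; apply: measurable_funM => //.
    apply: measurableT_comp; first exact: measurable_normal_pdf.
    exact: measurable_funB.
  - by move=> x; rewrite lee_fin mulr_ge0// normal_pdf_ge0.
  by apply: eq_integral => z _; rewrite -EFinM addrAC subrr add0r.
pose f (p : R * R) := (h p.2 * (pdf b (p.2 - p.1) * pdf a p.1))%:E.
have mf : measurable_fun setT f.
  apply/measurable_EFinP; apply: measurable_funM.
    exact: measurableT_comp.
  apply: measurable_funM.
    apply: measurableT_comp; first exact: measurable_normal_pdf.
    exact: measurable_funB.
  by apply: measurableT_comp => //; exact: measurable_normal_pdf.
have f0 p : (0 <= f p)%E by rewrite lee_fin !mulr_ge0// normal_pdf_ge0.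
transitivity (\int[mu]_y \int[mu]_w f (y, w))%E.
  under eq_integral do rewrite inner.
  have mi : measurable_fun setT (fun y => \int[mu]_w (h w * pdf b (w - y))%:E)%E.
    pose g (p : R * R) := (h p.2 * pdf b (p.2 - p.1))%:E.
    apply: (@measurable_fun_fubini_tonelli_F _ _ _ _ _ mu g).
      apply/measurable_EFinP; apply: measurable_funM; first exact: measurableT_comp.
      apply: measurableT_comp; first exact: measurable_normal_pdf.
      exact: measurable_funB.
    by move=> p; rewrite lee_fin mulr_ge0// normal_pdf_ge0.
  rewrite (ge0_integral_normal a mi); last first.
    move=> y; apply: integral_ge0 => w _.
    by rewrite lee_fin mulr_ge0// normal_pdf_ge0.
  apply: eq_integral => y _; rewrite muleC.
  have mg : measurable_fun setT (fun w => (h w * pdf b (w - y))%:E).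
    apply/measurable_EFinP; apply: measurable_funM => //.
    apply: measurableT_comp; first exact: measurable_normal_pdf.
    exact: measurable_funB.
  rewrite -(@ge0_integralZl _ _ _ mu _ measurableT _ mg).
  - by apply: eq_integral => w _; rewrite -EFinM /f/=; congr EFin; ring.
  - by move=> w _; rewrite lee_fin mulr_ge0// normal_pdf_ge0.
  - by rewrite lee_fin normal_pdf_ge0.
rewrite fubini_tonelli// ge0_integral_normal//; last exact/measurable_EFinP.
apply: eq_integral => w _; rewrite -EFinM /f/=.
under eq_integral do rewrite (normal_pdf_conv _ _ a0 b0 c0 cab) mulrA EFinM.
rewrite integralZl//; last exact: integrable_normal_pdf.
by rewrite integral_normal_pdf mule1.
Qed.

Lemma normal_conv a b c (h : R -> R) : 0 < a -> 0 < b -> 0 < c ->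
  c ^+ 2 = a ^+ 2 + b ^+ 2 -> bmeas h ->
  \int[N a]_y \int[N b]_z h (y + z) = \int[N c]_w h w.
Proof.
move=> a0 b0 c0 cab bh; have [mh [M hM]] := bh.
have badd : bmeas (fun p : R * measurableTypeR R => h (p.1 + p.2)).
  by apply: (bmeas_comp bh); exact: measurable_funD.
(* Adding the bound M makes the function nonnegative, as [ge0_normal_conv] requires. *)
have bM : bmeas (fun x => h x + M) by apply: bmeasD => //; exact: bmeas_cst.
have hM0 x : 0 <= h x + M.
  by have := hM x; rewrite ler_norml => /andP[? _]; lra.
have eL : \int[N a]_y \int[N b]_z (h (y + z) + M) = \int[N a]_y \int[N b]_z h (y + z) + M.
  rewrite -[X in _ = _ + X](mean_cst (N a)) -meanD.
  - apply: eq_Rintegral => y _; rewrite meanD ?mean_cst//.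
    + exact: (bmeas_section2 badd).
    + exact: bmeas_cst.
  - exact: (@bmeas_mean2 _ _ R (measurableTypeR R) R _ badd (N b)).
  - exact: bmeas_cst.
have eR : \int[N c]_w (h w + M) = \int[N c]_w h w + M.
  by rewrite -[X in _ = _ + X](mean_cst (N c)) -meanD//; exact: bmeas_cst.
suff : \int[N a]_y \int[N b]_z (h (y + z) + M) = \int[N c]_w (h w + M).
  by rewrite eL eR => /addIr.
have E := ge0_normal_conv a0 b0 c0 cab bM.1 hM0.
transitivity (fine (\int[N a]_y \int[N b]_z (h (y + z) + M)%:E)%E); last by rewrite E.
congr fine; apply: eq_integral => y _.
have bMy : bmeas (fun z : measurableTypeR R => h (y + z) + M).
  by apply: (bmeas_comp bM); exact: measurable_funD.
apply: fineK; apply: (integrable_fin_num measurableT).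
exact: bmeas_integrable bMy.
Qed.

End gaussian_convolution.

(** * The central limit theorem for bounded variables *)

Section smooth.
Context {R : realType}.
Implicit Types (M s x y z : R) (h : R -> R).
Local Notation N s := (normal_prob 0 s : probability (measurableTypeR R) R).

(* h1 and h2 play the role of the first two derivatives of h. *)
Definition smooth3 M h h1 h2 := [/\ bmeas h, bmeas h1, bmeas h2 &
  forall x y, `|h (x + y) - h x - h1 x * y - h2 x * y ^+ 2 / 2%:R| <= M * `|y| ^+ 3].

Definition gauss_avg s h x := \int[N s]_z h (x + z).

Lemma bmeas_shift h x : bmeas h -> bmeas (fun z => h (x + z)).
Proof. by move=> bh; apply: (bmeas_comp bh); exact: measurable_funD. Qed.

Lemma bmeas_gauss_avg s h : bmeas h -> bmeas (gauss_avg s h).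
Proof.
move=> bh.
have badd : bmeas (fun p : R * measurableTypeR R => h (p.1 + p.2)).
  by apply: (bmeas_comp bh); exact: measurable_funD.
exact: (@bmeas_mean2 _ _ R (measurableTypeR R) R _ badd (N s)).
Qed.

(** The Taylor estimate is uniform in x, so averaging over translates keeps the constant M; hence
    the error per replacement does not grow with their number. *)
Lemma smooth3_gauss_avg s M h h1 h2 : smooth3 M h h1 h2 ->
  smooth3 M (gauss_avg s h) (gauss_avg s h1) (gauss_avg s h2).
Proof.
move=> [bh bh1 bh2 H]; split; try exact: bmeas_gauss_avg.
move=> x y.
have b0 : bmeas (fun z : measurableTypeR R => h (x + z)) by exact: bmeas_shift.
have by0 : bmeas (fun z : measurableTypeR R => h (x + y + z)) by exact: bmeas_shift.
have b1 : bmeas (fun z : measurableTypeR R => h1 (x + z) * y).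
  by apply: bmeasM; [exact: bmeas_shift|exact: bmeas_cst].
have b2 : bmeas (fun z : measurableTypeR R => h2 (x + z) * (y ^+ 2 / 2%:R)).
  by apply: bmeasM; [exact: bmeas_shift|exact: bmeas_cst].
have b3 : bmeas (fun z : measurableTypeR R => h (x + y + z) - h (x + z)) by exact: bmeasB.
have b4 : bmeas (fun z : measurableTypeR R => h (x + y + z) - h (x + z) - h1 (x + z) * y).
  exact: bmeasB.
have b5 : bmeas (fun z : measurableTypeR R =>
    h (x + y + z) - h (x + z) - h1 (x + z) * y - h2 (x + z) * (y ^+ 2 / 2%:R)).
  exact: bmeasB.
have -> : gauss_avg s h (x + y) - gauss_avg s h x - gauss_avg s h1 x * y -
    gauss_avg s h2 x * y ^+ 2 / 2%:R = \int[N s]_z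
    (h (x + y + z) - h (x + z) - h1 (x + z) * y - h2 (x + z) * (y ^+ 2 / 2%:R)).
  rewrite (meanB (N s) b4 b2) (meanB (N s) b3 b1) (meanB (N s) by0 b0).
  rewrite -mulrA /gauss_avg -!RintegralZr//; apply: bmeas_integrable;
    exact: bmeas_shift.
apply: norm_mean_le => // z.
by rewrite (addrAC x y z) (mulrA (h2 _)); exact: H.
Qed.

(** The linear term integrates to 0, so up to M K the mean depends on xi through its variance only.
    Two centred variables of equal variance are compared through this common value. *)
Lemma smooth3_mean d (T : measurableType d) (Q : probability T R) (xi : T -> R)
    M h h1 h2 K x : 0 <= M ->
  smooth3 M h h1 h2 -> measurable_fun setT xi ->
  (forall k, (k <= 3)%N -> Q.-integrable setT (EFin \o (fun w => xi w ^+ k))) ->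
  \int[Q]_w xi w = 0 -> \int[Q]_w `|xi w| ^+ 3 <= K ->
  `|\int[Q]_w h (x + xi w) - (h x + h2 x / 2%:R * \int[Q]_w xi w ^+ 2)| <= M * K.
Proof.
move=> M0 [bh bh1 bh2 H] mxi ixi xi0 xi3.
have bhx : bmeas (fun w => h (x + xi w)).
  by apply: (bmeas_comp bh); exact: measurable_funD.
have i0 : Q.-integrable setT (EFin \o (fun w => h (x + xi w))) by exact: bmeas_integrable.
have ic : Q.-integrable setT (EFin \o (fun=> h x)) by apply: bmeas_integrable; exact: bmeas_cst.
have i1 : Q.-integrable setT (EFin \o xi).
  by have := ixi 1%N isT.
have i2 := ixi 2%N isT.
have i3 : Q.-integrable setT (EFin \o (fun w => `|xi w| ^+ 3)).
  have := integrable_norm (ixi 3%N isT).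
  by under [X in _.-integrable _ (_ \o X)]eq_fun do rewrite normrX.
have iZ (r : R) (f : T -> R) : Q.-integrable setT (EFin \o f) ->
    Q.-integrable setT (EFin \o (fun w => r * f w)).
  move=> fi; have -> : EFin \o (fun w => r * f w) = (fun w => r%:E * (f w)%:E)%E.
    exact/funext.
  exact: integrableZl.
have iB (f g : T -> R) : Q.-integrable setT (EFin \o f) -> Q.-integrable setT (EFin \o g) ->
    Q.-integrable setT (EFin \o (fun w => f w - g w)).
  move=> fi gi; have -> : EFin \o (fun w => f w - g w) = ((EFin \o f) \- (EFin \o g))%E.
    exact/funext.
  exact: integrableB.
have ia := iB _ _ i0 ic.
have ib := iB _ _ ia (iZ (h1 x) _ i1).
have ie := iB _ _ ib (iZ (h2 x / 2%:R) _ i2).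
have -> : \int[Q]_w h (x + xi w) - (h x + h2 x / 2%:R * \int[Q]_w xi w ^+ 2) =
   \int[Q]_w (h (x + xi w) - h x - h1 x * xi w - h2 x / 2%:R * xi w ^+ 2).
  rewrite (RintegralB measurableT ib (iZ (h2 x / 2%:R) _ i2)).
  rewrite (RintegralB measurableT ia (iZ (h1 x) _ i1)).
  rewrite (RintegralB measurableT i0 ic) mean_cst.
  rewrite (RintegralZl _ measurableT i1) (RintegralZl _ measurableT i2) xi0.
  by ring.
apply: le_trans (le_normr_Rintegral measurableT ie) _.
apply: le_trans (_ : \int[Q]_w (M * `|xi w| ^+ 3) <= _).
  apply: (le_Rintegral measurableT).
  - exact: integrable_norm.
  - exact: iZ.
  by move=> w _; rewrite -mulrA (mulrC 2^-1) mulrA; exact: H.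
by rewrite (RintegralZl _ measurableT i3); exact: ler_wpM2l.
Qed.

End smooth.

Section lindeberg.
Context d (T : measurableType d) (R : realType) (P : probability T R).
Variable X : nat -> T -> R.
Hypothesis mX : forall i, measurable_fun setT (X i).
Hypothesis indepX : forall (J : seq nat) (B : nat -> set R), uniq J ->
  (forall i, measurable (B i)) ->
  P (\bigcap_(i in [set` J]) (X i @^-1` B i)) =
  (\prod_(i <- J) P (X i @^-1` B i))%E.
Variables (B sigma : R).
Hypothesis sigma0 : 0 < sigma.
Hypothesis XB : forall i w, `|X i w| <= B.
Hypothesis EX : forall i, \int[P]_w X i w = 0.
Hypothesis VX : forall i, \int[P]_w X i w ^+ 2 = sigma ^+ 2.
Local Notation N s := (normal_prob 0 s : probability (measurableTypeR R) R).

Let C3 : R := 1 + 32%:R * Num.sqrt 2%:R.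

Let B0 : 0 <= B.
Proof. exact: le_trans (normr_ge0 _) (XB 0 point). Qed.

Let bX i : bmeas (X i). Proof. exact: bmeasP (XB i). Qed.

Let C30 : 0 <= C3.
Proof. by rewrite addr_ge0// mulr_ge0// sqrtr_ge0. Qed.

(** With S frozen, c X_k and the normal variable of deviation c sigma share mean and variance, so
    [smooth3_mean] applies to both. That S lives on [rest_type X k] expresses its independence of X
    k. *)
Lemma lindeberg_swap M h h1 h2 c k (S : rest_type X k -> R) :
  0 <= M -> 0 < c -> smooth3 M h h1 h2 -> measurable_fun setT S ->
  measurable_fun setT (S : T -> R) ->
  `|\int[P]_w h (S w + c * X k w) - \int[P]_w gauss_avg (c * sigma) h (S w)| <=
  M * ((c * B) ^+ 3 + C3 * (c * sigma) ^+ 3).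
Proof.
move=> M0 c0 hh mS mS'; have [bh bh1 bh2 _] := hh.
have cs0 : 0 < c * sigma by exact: mulr_gt0.
pose f (p : R * rest_type X k) := h (S p.2 + c * p.1).
have mf2 : measurable_fun setT (fun p : R * rest_type X k => S p.2).
  by apply: (@measurableT_comp _ _ _ _ _ _ S) => //; exact: measurable_snd.
have bf : bmeas f.
  apply: (bmeas_comp bh); apply: measurable_funD => //.
  exact: measurable_funM.
rewrite (mean_rest mX indepX bf) /f/=.
have bG := bmeas_gauss_avg (c * sigma) bh.
pose u x := \int[P]_w h (x + c * X k w).
have pw x : `|u x - gauss_avg (c * sigma) h x| <= M * ((c * B) ^+ 3 + C3 * (c * sigma) ^+ 3).
  have bcX j : bmeas (fun w => (c * X k w) ^+ j) by apply: bmeasX; exact: bmeasZ.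
  have e1 : `|u x - (h x + h2 x / 2%:R * (c * sigma) ^+ 2)| <= M * (c * B) ^+ 3.
    have -> : (c * sigma) ^+ 2 = \int[P]_w (c * X k w) ^+ 2.
      under [RHS]eq_Rintegral do rewrite exprMn.
      by rewrite meanZ ?VX ?exprMn//; exact: bmeasX.
    apply: (smooth3_mean x M0 hh).
    - exact: (bcX 1%N).1.
    - by move=> j _; apply: bmeas_integrable.
    - by rewrite meanZ// EX mulr0.
    apply: le_trans (ler_norm _) _; apply: norm_mean_le.
      by apply: bmeasX; apply: bmeas_norm; exact: bmeasZ.
    move=> w; rewrite normrX normr_id; apply: lerXn2r.
    - by rewrite nnegrE.
    - by rewrite nnegrE; apply: mulr_ge0 => //; exact: ltW.
    - by rewrite normrM gtr0_norm//; apply: ler_wpM2l; [exact: ltW|exact: XB].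
  have e2 : `|gauss_avg (c * sigma) h x - (h x + h2 x / 2%:R * (c * sigma) ^+ 2)| <=
      M * (C3 * (c * sigma) ^+ 3).
    rewrite -[X in _ - (_ + _ * X)](normal_variance cs0).
    apply: (@smooth3_mean _ _ (measurableTypeR R) (N (c * sigma)) (fun z => z) M h h1 h2 _ x) => //.
    - by move=> j j3; exact: normal_integrableX.
    - exact: normal_mean.
    have := normal_third_moment cs0.
    rewrite /Rintegral (mulrC (_ ^+ 3)) => h3.
    have h0 : (0 <= \int[N (c * sigma)]_z (`|z| ^+ 3)%:E)%E.
      by apply: integral_ge0 => z _; rewrite lee_fin exprn_ge0.
    have hfin : (\int[N (c * sigma)]_z (`|z| ^+ 3)%:E)%E \is a fin_num.
      by rewrite (ge0_fin_numE h0); exact: (le_lt_trans h3 (ltry _)).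
    by rewrite -lee_fin fineK.
  rewrite mulrDr; apply: le_trans (lerD e1 e2).
  rewrite -[X in _ <= _ + X]normrN; apply: le_trans (ler_normD _ _).
  by rewrite le_eqVlt; apply/orP; left; apply/eqP; congr Num.norm; ring.
have bu : bmeas u.
  pose g (p : R * T) := h (p.1 + c * X k p.2).
  have bg : bmeas g.
    apply: (bmeas_comp bh); apply: measurable_funD => //.
    apply: measurable_funM => //.
    by apply: (measurableT_comp (mX k)); exact: measurable_snd.
  exact: (bmeas_mean2 bg P).
have buS : bmeas (fun w : T => u (S w)) := bmeas_comp bu mS'.
have bGS : bmeas (fun w : T => gauss_avg (c * sigma) h (S w)) := bmeas_comp bG mS'.
rewrite -(meanB P buS bGS); apply: norm_mean_le; first exact: bmeasB.
by move=> w; exact: pw.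
Qed.

(** Iterated averaging adds independent normals, whose variances add up. The count starts at one
    because [normal_conv] needs positive deviations. *)
Lemma gauss_avg_iter h s n x : 0 < s -> bmeas h ->
  iter n.+1 (gauss_avg s) h x = \int[N (s * Num.sqrt n.+1%:R)]_z h (x + z).
Proof.
move=> s0 bh; elim: n x => [|n IH] x; first by rewrite sqrtr1 mulr1.
rewrite iterS {1}/gauss_avg.
under eq_Rintegral do rewrite IH.
have p1 : 0 < s * Num.sqrt n.+1%:R by rewrite mulr_gt0// sqrtr_gt0.
have p2 : 0 < s * Num.sqrt n.+2%:R by rewrite mulr_gt0// sqrtr_gt0.
have p3 : (s * Num.sqrt n.+2%:R) ^+ 2 = s ^+ 2 + (s * Num.sqrt n.+1%:R) ^+ 2.
  by rewrite !exprMn !sqr_sqrtr// -[n.+2%:R]natr1; ring.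
have E := normal_conv s0 p1 p2 p3 (bmeas_shift x bh).
apply: etrans E; apply: eq_Rintegral => y _; apply: eq_Rintegral => z _.
by rewrite addrA.
Qed.

(** The hybrid [a k] keeps the first k summands and represents the other n + 1 - k by iterates of
    [gauss_avg] on h. The n + 1 steps cost O(c^3) each with c = (n + 1)^(-1/2), which leaves one
    factor c. *)
Lemma lindeberg M h h1 h2 n : 0 <= M -> smooth3 M h h1 h2 ->
  `|\int[P]_w h ((Num.sqrt n.+1%:R)^-1 * \sum_(i < n.+1) X i w) - \int[N sigma]_z h z| <=
  M * (B ^+ 3 + C3 * sigma ^+ 3) * (Num.sqrt n.+1%:R)^-1.
Proof.
move=> M0 hh; set c := (_)^-1; have [bh _ _ _] := hh.
have q0 : 0 < Num.sqrt n.+1%:R :> R by rewrite sqrtr_gt0.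
have c0 : 0 < c by rewrite invr_gt0.
pose s := c * sigma; have s0 : 0 < s by exact: mulr_gt0.
pose u k := iter k (gauss_avg s) h.
have su k : exists h1' h2', smooth3 M (u k) h1' h2'.
  elim: k => [|k [a1 [a2 IH]]]; first by exists h1, h2.
  by exists (gauss_avg s a1), (gauss_avg s a2); exact: smooth3_gauss_avg.
pose S k w := c * \sum_(i < k) X i w.
pose a k := \int[P]_w u (n.+1 - k)%N (S k w).
have step k : (k < n.+1)%N ->
    `|a k.+1 - a k| <= M * ((c * B) ^+ 3 + C3 * (c * sigma) ^+ 3).
  move=> kn; have [a1 [a2 hu]] := su (n.+1 - k.+1)%N.
  rewrite /a (_ : (n.+1 - k = (n.+1 - k.+1).+1)%N); last by rewrite subnSK.
  rewrite [u _.+1]/u iterS -/(u _).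
  have -> : \int[P]_w u (n.+1 - k.+1)%N (S k.+1 w) =
            \int[P]_w u (n.+1 - k.+1)%N (S k w + c * X k w).
    by apply: eq_Rintegral => w _; rewrite /S big_ord_recr/= mulrDr.
  apply: (lindeberg_swap M0 c0 hu).
    apply: measurable_funM => //; apply: measurable_sum => i.
    by apply: measurable_rest; rewrite neq_ltn ltn_ord.
  by apply: measurable_funM => //; apply: measurable_sum => i.
have aN : a n.+1 = \int[P]_w h (c * \sum_(i < n.+1) X i w) by rewrite /a subnn.
have a0 : a 0%N = \int[N sigma]_z h z.
  rewrite /a subn0 /u.
  under eq_Rintegral do rewrite /S big_ord0 mulr0 gauss_avg_iter//.
  rewrite mean_cst (_ : s * _ = sigma); last by rewrite /s /c; field; rewrite gt_eqF.
  by apply: eq_Rintegral => z _; rewrite add0r.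
rewrite -aN -a0 -(telescope_sumr a (leq0n n.+1)).
apply: le_trans (ler_norm_sum _ _ _) _.
rewrite big_mkord; apply: (@le_trans _ _ (\sum_(i < n.+1)
    M * ((c * B) ^+ 3 + C3 * (c * sigma) ^+ 3))).
  by apply: ler_sum => i _; exact: step.
rewrite sumr_const card_ord -[leLHS]mulr_natl.
have -> : n.+1%:R = c ^- 2 by rewrite /c exprVn invrK sqr_sqrtr.
rewrite le_eqVlt; apply/orP; left; apply/eqP; field.
by rewrite gt_eqF.
Qed.

Lemma lindeberg_mean M h h1 h2 n : (0 < n)%N -> 0 <= M -> smooth3 M h h1 h2 ->
  `|\int[P]_w h (Num.sqrt n%:R * (n%:R^-1 * \sum_(i < n) X i w)) - \int[N sigma]_z h z| <=
  M * (B ^+ 3 + C3 * sigma ^+ 3) * (Num.sqrt n%:R)^-1.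
Proof.
case: n => // n _ M0 hh; have := lindeberg n M0 hh; congr (`|_ - _| <= _).
apply: eq_Rintegral => w _; congr h; rewrite mulrA; congr (_ * _).
have q0 : Num.sqrt n.+1%:R != 0 :> R by rewrite gt_eqF// sqrtr_gt0.
by rewrite -[X in _ / X](@sqr_sqrtr R)//; field.
Qed.

End lindeberg.

(** * Cubic splines between indicators of half-lines *)

Section spline.
Context {R : realType}.
Implicit Types x y t r k : R.

(** For |y| > 1 boundedness of h suffices, for |y| <= 1 the Taylor estimate does. Lipschitz test
    functions turn a remainder that is small in mean into a small change of expectation. *)
Lemma smooth3_lipschitz (M : R) (h h1 h2 : R -> R) : 0 <= M ->
  smooth3 M h h1 h2 ->
  exists2 L, 0 <= L & forall x y, `|h (x + y) - h x| <= L * `|y|.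
Proof.
move=> M0 [[_ [A hA]] [_ [A1 hA1]] [_ [A2 hA2]] H].
have A0 : 0 <= A := le_trans (normr_ge0 _) (hA 0).
have A10 : 0 <= A1 := le_trans (normr_ge0 _) (hA1 0).
have A20 : 0 <= A2 := le_trans (normr_ge0 _) (hA2 0).
exists (2%:R * A + A1 + A2 + M); first by rewrite !addr_ge0// mulr_ge0.
move=> x y; have y0 := normr_ge0 y; have [y1|y1] := lerP `|y| 1; last first.
  apply: (@le_trans _ _ (2%:R * A)).
    apply: le_trans (ler_normB _ _) _.
    by rewrite mulr_natl mulr2n; exact: lerD.
  by rewrite -!addrA mulrDl; apply: (@le_trans _ _ (2%:R * A * `|y|)); nra.
have -> : h (x + y) - h x = (h (x + y) - h x - h1 x * y - h2 x * y ^+ 2 / 2%:R)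
    + h1 x * y + h2 x * y ^+ 2 / 2%:R by ring.
apply: le_trans (ler_normD _ _) _; apply: le_trans (lerD (ler_normD _ _) (lexx _)) _.
apply: (@le_trans _ _ (M * `|y| ^+ 3 + A1 * `|y| + A2 * `|y|)).
  apply: lerD; first apply: lerD.
  - exact: H.
  - by rewrite normrM; exact: ler_wpM2r.
  - rewrite !normrM -mulrA; apply: ler_pM => //.
    rewrite (_ : `|2%:R^-1| = 2%:R^-1 :> R); last by rewrite ger0_norm ?invr_ge0.
    by nra.
have y3 : `|y| ^+ 3 <= `|y| by rewrite !exprS expr0 mulr1; nra.
by nra.
Qed.

Let pos x := Num.max x 0.

Let posP x : (0 <= x /\ pos x = x) \/ (x <= 0 /\ pos x = 0).
Proof. by rewrite /pos; case: (leP x 0) => h; [right|left; split=> //; exact: ltW]. Qed.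

(** The second derivative 6 max(x, 0) of the truncated cube has Lipschitz constant 6, which the 1/6
    of the third-order remainder cancels. *)
Let pos_taylor x y :
  `|pos (x + y) ^+ 3 - pos x ^+ 3 - 3%:R * pos x ^+ 2 * y - 3%:R * pos x * y ^+ 2|
    <= `|y| ^+ 3.
Proof.
have [[xy0 ->]|[xy0 ->]] := posP (x + y); have [[x0 ->]|[x0 ->]] := posP x.
- rewrite (_ : _ - _ = y ^+ 3); last by ring.
  by rewrite normrX.
- have y0 : 0 <= y by lra.
  rewrite (_ : _ - _ = (x + y) ^+ 3); last by ring.
  rewrite (ger0_norm y0) ger0_norm ?exprn_ge0//.
  by apply: lerXn2r; rewrite ?nnegrE//; lra.
- have y0 : y <= 0 by lra.
  rewrite (_ : _ - _ = - (x ^+ 3 + 3%:R * x ^+ 2 * y + 3%:R * x * y ^+ 2)); last by ring.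
  rewrite (ler0_norm y0) -[x in x ^+ 3](addrK y) normrN.
  pose u := - y; pose v := - (x + y).
  have u0 : 0 <= u by rewrite /u; lra.
  have v0 : 0 <= v by rewrite /v; lra.
  have vu : v <= u by rewrite /u /v; lra.
  have -> : (x + y - y) ^+ 3 + 3%:R * x ^+ 2 * y + 3%:R * x * y ^+ 2 = u ^+ 3 - v ^+ 3.
    by rewrite /u /v; ring.
  have vu3 : v ^+ 3 <= u ^+ 3 by apply: lerXn2r; rewrite ?nnegrE.
  have v3 : 0 <= v ^+ 3 by rewrite exprn_ge0.
  by rewrite ger0_norm ?subr_ge0// -/u; lra.
- rewrite (_ : _ - _ = 0); last by ring.
  by rewrite normr0 exprn_ge0.
Qed.

(* D3 is the third difference, so that s0 is the integral of the quadratic B-spline, which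
   climbs from 0 to 1 on [0, 3], and s1 and s2 are its first two derivatives. *)
Let D3 (p : R -> R) t := p t - 3%:R * p (t - 1) + 3%:R * p (t - 2%:R) - p (t - 3%:R).
Let s0 t := D3 (fun x => pos x ^+ 3) t / 6%:R.
Let s1 t := D3 (fun x => pos x ^+ 2) t / 2%:R.
Let s2 t := D3 pos t.

Let s_bounds t : [/\ 0 <= s0 t <= 1, `|s1 t| <= 1, `|s2 t| <= 1,
  t <= 0 -> s0 t = 0 & 3%:R <= t -> s0 t = 1].
Proof.
rewrite /s0 /s1 /s2 /D3.
have [[a0 ->]|[a0 ->]] := posP t; have [[b0 ->]|[b0 ->]] := posP (t - 1);
have [[c0 ->]|[c0 ->]] := posP (t - 2%:R); have [[e0 ->]|[e0 ->]] := posP (t - 3%:R);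
try (exfalso; lra); rewrite !ler_norml !exprS !expr0 !mulr1;
split; do ?[apply/andP; split]; do ?[move=> ?]; try nra.
(* The goals left are the two bounds on s0 for t in [2, 3], where symmetry gives 1 - (3 - t)^3 / 6,
   and then the same bounds for t in [1, 2]. *)
- have c1 : 0 <= (3%:R - t) ^+ 3 <= 1.
    by rewrite exprn_ge0 ?exprn_ile1//; lra.
  rewrite (_ : _ / 6 = 1 - (3%:R - t) ^+ 3 / 6%:R); last by field.
  by move: c1 => /andP[]; move: ((3%:R - t) ^+ 3) => u ? ?; lra.
- have c1 : 0 <= (3%:R - t) ^+ 3 <= 1.
    by rewrite exprn_ge0 ?exprn_ile1//; lra.
  rewrite (_ : _ / 6 = 1 - (3%:R - t) ^+ 3 / 6%:R); last by field.
  by move: c1 => /andP[]; move: ((3%:R - t) ^+ 3) => u ? ?; lra.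
- pose v := t - 1; have v0 : 0 <= v by []; have v1 : v <= 1 by rewrite /v; lra.
  rewrite (_ : _ / 6 = (1 + 3%:R * v + v ^+ 2 + 2%:R * (v ^+ 2 * (1 - v))) / 6%:R); last first.
    by rewrite /v; field.
  have v3 : 0 <= v ^+ 2 * (1 - v) by rewrite mulr_ge0 ?sqr_ge0 ?subr_ge0.
  by have h := sqr_ge0 v; lra.
- pose v := t - 1; have v0 : 0 <= v by []; have v1 : v <= 1 by rewrite /v; lra.
  rewrite (_ : _ / 6 = (1 + 3%:R * v + v ^+ 2 + 2%:R * (v ^+ 2 * (1 - v))) / 6%:R); last first.
    by rewrite /v; field.
  have v2 : v ^+ 2 <= 1 by exact: exprn_ile1.
  have v3 : v ^+ 2 * (1 - v) <= 1 - v by rewrite ler_piMl ?subr_ge0.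
  by lra.
Qed.

Let mpos : measurable_fun setT pos.
Proof. by apply: measurable_maxr. Qed.

Let mD3 (p : R -> R) : measurable_fun setT p -> measurable_fun setT (D3 p).
Proof.
move=> mp; have mps a : measurable_fun setT (fun t => p (t - a)).
  by apply: measurableT_comp => //; exact: measurable_funB.
apply: measurable_funB => //; apply: measurable_funD.
  by apply: measurable_funB => //; exact: measurable_funM.
exact: measurable_funM.
Qed.

Let s0_taylor t y : `|s0 (t + y) - s0 t - s1 t * y - s2 t * y ^+ 2 / 2%:R| <= 2%:R * `|y| ^+ 3.
Proof.
(* The third difference weighs four such remainders by 1, 3, 3, 1; after division by 6 the total is
   8/6 <= 2. *)
pose E x := pos (x + y) ^+ 3 - pos x ^+ 3 - 3%:R * pos x ^+ 2 * y - 3%:R * pos x * y ^+ 2.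
have EE x : `|E x| <= `|y| ^+ 3 := pos_taylor x y.
have -> : s0 (t + y) - s0 t - s1 t * y - s2 t * y ^+ 2 / 2%:R =
  (E t - 3%:R * E (t - 1) + 3%:R * E (t - 2%:R) - E (t - 3%:R)) / 6%:R.
  by rewrite /E /s0 /s1 /s2 /D3 -!(addrAC t y); field.
have := EE t; have := EE (t - 1); have := EE (t - 2%:R); have := EE (t - 3%:R).
move: (`|y| ^+ 3) => u; rewrite !ler_norml => /andP[? ?] /andP[? ?] /andP[? ?] /andP[? ?].
by apply/andP; split; lra.
Qed.

Lemma smooth_step k r : 0 < k -> exists (M : R) (h h1 h2 : R -> R),
  [/\ 0 <= M, smooth3 M h h1 h2, (forall x, 0 <= h x <= 1),
    (forall x, x <= r -> h x = 1) & (forall x, r + k <= x -> h x = 0)].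
Proof.
(* The factor q stretches [r, r + k] onto [0, 3], the interval on which the spline climbs. *)
move=> k0; pose q := 3%:R / k; have q0 : 0 < q by rewrite divr_gt0.
have maff : measurable_fun setT (fun x => q * (x - r)).
  by apply: measurable_funM => //; exact: measurable_funB.
exists (2%:R * q ^+ 3), (fun x => 1 - s0 (q * (x - r))),
  (fun x => - (q * s1 (q * (x - r)))), (fun x => - (q ^+ 2 * s2 (q * (x - r)))).
have bs0 : bmeas s0.
  apply: (@bmeasP _ _ _ _ 1).
    by apply: measurable_funM => //; apply: mD3; exact: measurable_funX.
  by move=> x; have [/andP[? ?] _ _ _ _] := s_bounds x; rewrite ger0_norm.
have bs1 : bmeas s1.
  apply: (@bmeasP _ _ _ _ 1).
    by apply: measurable_funM => //; apply: mD3; exact: measurable_funX.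
  by move=> x; have [] := s_bounds x.
have bs2 : bmeas s2.
  apply: (@bmeasP _ _ _ _ 1); first exact: mD3.
  by move=> x; have [] := s_bounds x.
split.
- by rewrite mulr_ge0// exprn_ge0// ltW.
- split.
  + by apply: bmeasB; [exact: bmeas_cst|exact: (bmeas_comp bs0)].
  + by apply: bmeasN; apply: bmeasZ; exact: (bmeas_comp bs1).
  + by apply: bmeasN; apply: bmeasZ; exact: (bmeas_comp bs2).
  move=> x y; have := s0_taylor (q * (x - r)) (q * y).
  rewrite normrM (gtr0_norm q0) -normrN => h.
  rewrite [leRHS](_ : _ = 2%:R * (q * `|y|) ^+ 3); last by ring.
  apply: le_trans h.
  have -> : q * (x + y - r) = q * (x - r) + q * y by ring.
  by rewrite le_eqVlt; apply/orP; left; apply/eqP; congr Num.norm; ring.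
- by move=> x; have [/andP[? ?] _ _ _ _] := s_bounds (q * (x - r)); apply/andP; split; lra.
- move=> x xr; have [_ _ _ e _] := s_bounds (q * (x - r)).
  by rewrite e ?subr0// pmulr_rle0// subr_le0.
- move=> x xr; have [_ _ _ _ e] := s_bounds (q * (x - r)).
  by rewrite e ?subrr// /q mulrAC ler_pdivlMr// ler_pM2l//; lra.
Qed.

End spline.

(** * Moments of the cube root of an exponential *)

Section exponential_cube_root.
Context d (T : measurableType d) (R : realType) (P : probability T R).
Variables (lambda : R) (lambda0 : 0 < lambda).
Variable X : {mfun T >-> R}.
Hypothesis lawX : forall B : set R, measurable B ->
  distribution P X B = exponential_prob lambda B.
Local Notation mu := (@lebesgue_measure R).

(* The absolute value keeps [root_exp] in (0, 1] on the null set of negative x. *)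
Definition root_exp (x : R) : R := expR (- (lambda / 3%:R) * `|x|).

Let cexp : continuous (fun x : R => expR (- (lambda / 3%:R) * x)).
Proof.
move=> x; apply: continuous_comp; last exact: continuous_expR.
by apply: continuousM; [exact: cst_continuous|exact: cvg_id].
Qed.

Lemma continuous_root_exp : continuous root_exp.
Proof.
move=> x; apply: (@continuous_comp _ _ _ (fun x : R => `|x|)
  (fun x : R => expR (- (lambda / 3%:R) * x))); last exact: cexp.
exact: norm_continuous.
Qed.

Let ge0_integral_X (f : R -> R) : measurable_fun setT f -> (forall x, 0 <= f x) ->
  (\int[P]_w (f (X w))%:E = \int[mu]_x (f x * exponential_pdf lambda x)%:E)%E.
Proof.
move=> mf f0; have mEf : measurable_fun setT (EFin \o f) by exact/measurable_EFinP.
have mX : @measurable_fun _ _ T (measurableTypeR R) setT X.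
  by move=> _ B mB; exact: (measurable_funPT X measurableT B mB).
pose X' : {mfun T >-> measurableTypeR R} :=
  @mfun_Sub _ _ T (measurableTypeR R) X (mem_set mX).
transitivity (\int[distribution P X']_x (f x)%:E)%E.
  by rewrite ge0_integral_distribution// => x; rewrite lee_fin.
rewrite (@ge0_integral_density _ _ (exponential_pdf lambda))//.
- by move=> x; apply: exponential_pdf_ge0; exact: ltW.
- exact: measurable_exponential_pdf.
Qed.

(* [root_exp] X has density 3 v^2 on [0, 1]; Phi is a primitive of 3 v^2 phi(v). *)
Variables (phi Phi : R -> R).
Hypothesis phi_ge0 : forall v : R, 0 < v -> v <= 1 -> 0 <= phi v.
Hypothesis cphi : forall v : R, 0 < v -> {for v, continuous phi}.
Hypothesis dPhi : forall v : R, 0 < v -> is_derive v (1 : R) Phi (3%:R * v ^+ 2 * phi v).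

Let e x : R := expR (- (lambda / 3%:R) * x).
(** lambda e(x)^3 is the exponential density, and [F] is a primitive of [g] by the chain rule: the
    fundamental theorem of calculus in x replaces a change of variables to v. *)
Let g x := phi (e x) * (lambda * e x ^+ 3).
Let F x := - Phi (e x).

Let e_pos x : 0 < e x. Proof. exact: expR_gt0. Qed.

Let e_le1 x : 0 <= x -> e x <= 1.
Proof.
by move=> x0; rewrite /e -expR0 ler_expR mulNr oppr_le0 mulr_ge0// divr_ge0// ltW.
Qed.

Let e_root x : 0 <= x -> root_exp x = e x.
Proof. by move=> x0; rewrite /root_exp ger0_norm. Qed.

Let g_ge0 x : 0 <= x -> 0 <= g x.
Proof.
by move=> x0; rewrite /g mulr_ge0 ?phi_ge0 ?e_le1// mulr_ge0 ?exprn_ge0// ltW.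
Qed.

Let cphie : continuous (phi \o e).
Proof. by move=> x; apply: continuous_comp; [exact: cexp|exact: cphi]. Qed.

Let cg : continuous g.
Proof.
rewrite /g => x; apply: (@continuousM _ _ (phi \o e) (fun x => lambda * e x ^+ 3)).
  exact: cphie.
apply: continuousM; first exact: cst_continuous.
apply: (@continuous_comp _ _ _ e (fun y : R => y ^+ 3)); first exact: cexp.
exact: exprn_continuous.
Qed.

Let dF x : is_derive x (1 : R) F (g x).
Proof.
have de : is_derive x (1 : R) e (- (lambda / 3%:R) * e x).
  have h : is_derive x (1 : R) (fun x : R => - (lambda / 3%:R) * x) (- (lambda / 3%:R)).
    have := is_deriveZ (- (lambda / 3%:R)) (@is_derive_id _ _ x (1 : R)).
    by rewrite /GRing.scale/= mulr1.
  have hc := @is_derive1_comp _ (@expR R) _ x _ _ (is_derive_expR _) h.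
  by apply: is_derive_eq hc _; exact: mulrC.
have h := @is_derive1_comp _ Phi e x _ _ (dPhi (e_pos x)) de.
have hN := is_deriveN h.
apply: is_derive_eq hN _.
by rewrite /g; field.
Qed.

Let e3 x : e x ^+ 3 = expR (- lambda * x).
Proof. by rewrite /e -expRM_natl; congr expR; field. Qed.

Let F_derivable x : derivable F x 1. Proof. exact: ex_derive. Qed.

Let F' : (F^`())%classic = g.
Proof. by apply/funext => x; rewrite derive1E; exact: derive_val. Qed.

Let cF : continuous F.
Proof. by move=> x; apply: differentiable_continuous; apply/derivable1_diffP. Qed.

Section cut.
Variables (delta : R) (delta0 : 0 < delta) (delta1 : delta <= 1).
Let r := - (3%:R / lambda) * ln delta.

Let r0 : 0 <= r.
Proof. by rewrite /r mulNr -mulrN mulr_ge0 ?divr_ge0 ?(ltW lambda0)// oppr_ge0 ln_le0. Qed.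

Let er : e r = delta.
Proof.
rewrite /e /r mulrA (_ : - (lambda / 3%:R) * - (3%:R / lambda) = 1).
  by rewrite mul1r lnK.
by field; rewrite gt_eqF.
Qed.

Let e_lt x y : (e x < e y) = (y < x).
Proof. by rewrite /e ltr_expR !mulNr ltrN2 ltr_pM2l// divr_gt0. Qed.

Let m_phi_root : measurable_fun setT (fun x => phi (root_exp x)).
Proof.
apply: continuous_measurable_fun => x.
by apply: continuous_comp; [exact: continuous_root_exp|apply: cphi; exact: expR_gt0].
Qed.

Let m_root : measurable_fun setT root_exp.
Proof. exact: continuous_measurable_fun continuous_root_exp. Qed.

Let root_le1 x : root_exp x <= 1.
Proof.
by rewrite /root_exp -expR0 ler_expR mulNr oppr_le0 mulr_ge0// divr_ge0// ltW.
Qed.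

Let phi_root_ge0 x : 0 <= phi (root_exp x).
Proof. by rewrite phi_ge0 ?expR_gt0. Qed.

Let fpdfE (b : bool) x : 0 <= x ->
  phi (root_exp x) * b%:R * exponential_pdf lambda x = if b then g x else 0.
Proof.
move=> x0; rewrite exponential_pdfE// e_root// /g e3.
by case: b; rewrite ?mulr1 ?mulr0 ?mul0r// mulrA.
Qed.

Let pdf_lt0 x : x < 0 -> exponential_pdf lambda x = 0.
Proof. exact: lt0_exponential_pdf. Qed.

Lemma mean_root_exp_lt : {for 0, continuous Phi} ->
  \int[P]_w (phi (root_exp (X w)) * (root_exp (X w) < delta)%R%:R) = Phi delta - Phi 0.
Proof.
move=> cPhi.
suff H : (\int[P]_w (phi (root_exp (X w)) * (root_exp (X w) < delta)%R%:R)%:E =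
    (Phi delta - Phi 0)%:E)%E by rewrite /Rintegral H.
rewrite (@ge0_integral_X (fun x => phi (root_exp x) * (root_exp x < delta)%R%:R)); last 2 first.
- apply: measurable_funM => //.
  exact: (bmeas_lt m_root (measurable_cst delta)).1.
- by move=> x; rewrite mulr_ge0.
transitivity (\int[mu]_(x in `]r, +oo[) (g x)%:E)%E.
  rewrite [RHS]integral_mkcond; apply: eq_integral => x _; rewrite patchE.
  have [x0|x0] := ltP x 0.
    rewrite pdf_lt0// mulr0 memNset//= in_itv/= andbT => rx.
    by move: (lt_trans rx x0); rewrite ltNge r0.
  rewrite fpdfE// e_root// -er e_lt; case: ifPn => rx.
    by rewrite mem_set//= in_itv/= rx.
  by rewrite memNset//= in_itv/= andbT; exact/negP.
rewrite integral_itv_obnd_cbnd; last first.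
  by apply/measurable_EFinP/measurable_funTS; exact: continuous_measurable_fun.
(* The primitive tends to - Phi 0 at infinity, since e tends to 0 and Phi is continuous there. *)
rewrite (@ge0_continuous_FTC2y _ g F r (- Phi 0))//.
- by rewrite /F er -EFinB; congr EFin; ring.
- by move=> x rx; apply: g_ge0; exact: le_trans rx.
- exact: continuous_subspaceT.
- rewrite /F; apply: cvgN; apply: (@cvg_comp _ _ _ e Phi _ (nbhs 0)); last exact: cPhi.
  rewrite /e; under eq_fun do rewrite mulNr.
  apply: (@cvg_comp _ _ _ (fun x => lambda / 3%:R * x) (fun z => expR (- z)) _ (pinfty_nbhs R)).
    by apply: gt0_cvgMry; [exact: divr_gt0|exact: cvg_id].
  exact: cvgr_expR.
- by apply: cvg_at_right_filter; exact: cF.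
- by move=> x _; rewrite F'.
Qed.

Lemma mean_root_exp_gt :
  \int[P]_w (phi (root_exp (X w)) * (delta < root_exp (X w))%R%:R) = Phi 1 - Phi delta.
Proof.
suff H : (\int[P]_w (phi (root_exp (X w)) * (delta < root_exp (X w))%R%:R)%:E =
    (Phi 1 - Phi delta)%:E)%E by rewrite /Rintegral H.
rewrite (@ge0_integral_X (fun x => phi (root_exp x) * (delta < root_exp x)%R%:R)); last 2 first.
- apply: measurable_funM => //.
  exact: (bmeas_lt (measurable_cst delta) m_root).1.
- by move=> x; rewrite mulr_ge0.
transitivity (\int[mu]_(x in `[0%R, r[) (g x)%:E)%E.
  rewrite [RHS]integral_mkcond; apply: eq_integral => x _; rewrite patchE.
  have [x0|x0] := ltP x 0.
    by rewrite pdf_lt0// mulr0 memNset//= in_itv/= leNgt x0.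
  rewrite fpdfE// e_root// -er e_lt; case: ifPn => rx.
    by rewrite mem_set//= in_itv/= x0 rx.
  by rewrite memNset//= in_itv/= x0; exact/negP.
rewrite integral_itv_bndo_bndc; last first.
  by apply/measurable_EFinP/measurable_funTS; exact: continuous_measurable_fun.
(* delta = 1 gives r = 0 and a degenerate interval, which the fundamental theorem excludes. *)
have [r_eq0|r_gt0] := eqVneq r 0.
  have d1 : delta = 1 by rewrite -er r_eq0 /e mulr0 expR0.
  by rewrite r_eq0 set_itv1 integral_set1 d1 subrr.
rewrite (@continuous_FTC2 _ g F 0 r)//.
- by rewrite /F er /e mulr0 expR0 -EFinB; congr EFin; ring.
- by rewrite lt_neqAle eq_sym r_gt0.
- exact: continuous_subspaceT.
- split=> [x _||]; first exact: F_derivable.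
  + by apply: cvg_at_right_filter; exact: cF.
  + by apply: cvg_at_left_filter; exact: cF.
- by move=> x _; rewrite F'.
Qed.

End cut.

End exponential_cube_root.

(** * Moments and conditional expectations under the density 3 v^2 *)

Section root_exp_law.
Context d (T : measurableType d) (R : realType) (P : probability T R).
Variables (lambda : R) (lambda0 : 0 < lambda).
Variable X : {mfun T >-> R}.
Hypothesis lawX : forall B : set R, measurable B ->
  distribution P X B = exponential_prob lambda B.
Let V w := root_exp lambda (X w).

Lemma is_derive_powZ (k : nat) (a v : R) :
  is_derive v (1 : R) (fun x : R => a * x ^+ k.+1) (a * k.+1%:R * v ^+ k).
Proof.
have h := is_deriveZ a (is_deriveX k.+1 (@is_derive_id _ _ v (1 : R))).
have -> : (fun x : R => a * x ^+ k.+1) = a \*: (id ^+ k.+1).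
  by apply/funext => x; rewrite /GRing.scale/= fctE.
by apply: is_derive_eq h _; rewrite /GRing.scale/= mulr1 mulrA.
Qed.

Lemma mean_root_exp_pow_lt k delta : 0 < delta -> delta <= 1 ->
  \int[P]_w (V w ^+ k * (V w < delta)%R%:R) = 3%:R / k.+3%:R * delta ^+ k.+3.
Proof.
move=> d0 d1.
rewrite (@mean_root_exp_lt _ _ _ _ _ lambda0 _ lawX (fun v => v ^+ k)
   (fun v => 3%:R / k.+3%:R * v ^+ k.+3) _ _ _ _ d0 d1).
- by rewrite expr0n/= mulr0 subr0.
- by move=> v v0 _; rewrite exprn_ge0// ltW.
- by move=> v _; exact: exprn_continuous.
- move=> v _; apply: is_derive_eq (is_derive_powZ _ _ _) _.
  by rewrite divfK ?pnatr_eq0// !exprS expr0; ring.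
- apply: differentiable_continuous; apply/derivable1_diffP.
  exact: (@ex_derive _ _ _ _ _ _ _ (is_derive_powZ k.+2 (3%:R / k.+3%:R) 0)).
Qed.

Let V_pos w : 0 < V w. Proof. exact: expR_gt0. Qed.

Let V_le1 w : V w <= 1.
Proof.
by rewrite /V /root_exp -expR0 ler_expR mulNr oppr_le0 mulr_ge0// divr_ge0// ltW.
Qed.

Let mV : measurable_fun setT V.
Proof.
apply: (@measurableT_comp _ _ _ _ _ _ (root_exp lambda)) => //.
exact: continuous_measurable_fun (@continuous_root_exp _ lambda).
Qed.

Lemma bmeas_root_exp : bmeas V.
Proof. by apply: (@bmeasP _ _ _ _ 1) => // w; rewrite gtr0_norm. Qed.

Lemma mean_root_exp_gt_cst delta : 0 < delta -> delta <= 1 ->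
  \int[P]_w (delta < V w)%R%:R = 1 - delta ^+ 3.
Proof.
move=> d0 d1.
have ge0 (v : R) : 0 < v -> v <= 1 -> (0 : R) <= (fun=> 1) v by [].
have cc (v : R) : 0 < v -> {for v, continuous (fun=> 1 : R)}.
  by move=> _; exact: cst_continuous.
have dd (v : R) : 0 < v ->
    is_derive v (1 : R) (fun v : R => 1 * v ^+ 3) (3%:R * v ^+ 2 * (fun=> 1) v).
  by move=> _; apply: is_derive_eq (is_derive_powZ _ _ _) _; rewrite mul1r mulr1.
have := mean_root_exp_gt lambda0 lawX ge0 cc dd d0 d1.
rewrite !mul1r expr1n => <-.
by apply: eq_Rintegral => w _; rewrite mul1r.
Qed.

Lemma mean_root_exp_lt_cst delta : 0 < delta -> delta <= 1 ->
  \int[P]_w (V w < delta)%R%:R = delta ^+ 3.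
Proof.
move=> d0 d1; have := mean_root_exp_pow_lt 0 d0 d1.
rewrite divff ?pnatr_eq0// mul1r => <-.
by apply: eq_Rintegral => w _; rewrite expr0 mul1r.
Qed.

Lemma mean_root_exp_eq delta : 0 < delta -> delta <= 1 ->
  \int[P]_w (V w == delta)%:R = 0.
Proof.
move=> d0 d1; have b1 : bmeas (fun w => (V w < delta)%R%:R : R).
  exact: bmeas_lt.
have b2 : bmeas (fun w => (delta < V w)%R%:R : R) by exact: bmeas_lt.
have -> : \int[P]_w (V w == delta)%:R =
    \int[P]_w (1 - (V w < delta)%R%:R - (delta < V w)%R%:R).
  by apply: eq_Rintegral => w _; case: ltgtP => _; rewrite /= ?subr0 ?subrr.
have b0 : bmeas (fun w => 1 - (V w < delta)%R%:R : R) by apply: bmeasB => //; exact: bmeas_cst.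
rewrite (meanB P b0 b2) (meanB P (bmeas_cst _ _) b1) mean_cst.
by rewrite mean_root_exp_lt_cst// mean_root_exp_gt_cst//; ring.
Qed.

(** The truncated moment at delta = 1 misses only the event V = 1, which has probability 0. *)
Lemma mean_root_exp_pow k : \int[P]_w V w ^+ k = 3%:R / k.+3%:R.
Proof.
have b1 : bmeas (fun w => (V w < 1)%R%:R : R) by exact: bmeas_lt.
have bk : bmeas (fun w => V w ^+ k) by apply: bmeasX; exact: bmeas_root_exp.
have bkl : bmeas (fun w => V w ^+ k * (V w < 1)%R%:R) by exact: bmeasM.
have := mean_root_exp_pow_lt k ltr01 (lexx 1); rewrite expr1n mulr1 => <-.
apply/eqP; rewrite eq_sym -subr_eq0 -(meanB P bkl bk) -normr_le0.
apply: le_trans (norm_mean P (bmeasB bkl bk)) _.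
have -> : 0 = \int[P]_w (1 - (V w < 1)%R%:R) :> R.
  by rewrite (meanB P (bmeas_cst _ _) b1) mean_cst mean_root_exp_lt_cst// expr1n subrr.
apply: le_mean.
- by apply: bmeas_norm; exact: bmeasB.
- by apply: bmeasB => //; exact: bmeas_cst.
move=> w; case: (V w < 1) => /=; first by rewrite mulr1 !subrr normr0.
rewrite mulr0 sub0r normrN subr0 normrX gtr0_norm//.
by apply: exprn_ile1 => //; exact: ltW.
Qed.

Lemma cube_rootP (s : R) : 0 < s -> s <= 1 ->
  exists delta, [/\ 0 < delta, delta <= 1 & delta ^+ 3 = s].
Proof.
move=> s0 s1; exists (expR (ln s / 3%:R)); split; first exact: expR_gt0.
  by rewrite -expR0 ler_expR ler_pdivrMr// mul0r ln_le0.
by rewrite -expRM_natl -[RHS]lnK//; congr expR; field.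
Qed.

Let cube_lt (x y : R) : 0 <= x -> 0 <= y -> (x ^+ 3 < y ^+ 3) = (x < y).
Proof. by move=> x0 y0; rewrite ltr_pXn2r. Qed.

(* The probability that D < V^3 c when V has density 3 v^2 on [0, 1]. *)
Definition excess (D c : R) : R := Num.max (1 - D / c) 0.

Lemma excess_ge0 D c : 0 <= excess D c.
Proof. by rewrite /excess le_max lexx orbT. Qed.

Lemma excess_le1 D c : 0 <= D / c -> excess D c <= 1.
Proof. by move=> Dc; rewrite /excess ge_max ler01 andbT; lra. Qed.

(** V^3 is uniform, so it exceeds D / c with probability 1 - D / c when this is positive. *)
Lemma mean_beats D c : 0 < D -> 0 < c -> c <= 1 ->
  \int[P]_w (D < V w ^+ 3 * c)%R%:R = excess D c.
Proof.
move=> D0 c0 c1; have [cD|Dc] := leP c D.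
  rewrite /excess max_r; last by rewrite subr_le0 ler_pdivlMr// mul1r.
  rewrite -[RHS](mean_cst P); apply: eq_Rintegral => w _.
  have -> // : (D < V w ^+ 3 * c) = false.
  apply/negbTE; rewrite -leNgt; apply: le_trans cD.
  by rewrite ler_piMl ?(ltW c0)// exprn_ile1// ltW.
have s0 : 0 < D / c by exact: divr_gt0.
have s1 : D / c <= 1 by rewrite ler_pdivrMr// mul1r ltW.
have [delta [d0 d1 d3]] := cube_rootP s0 s1.
rewrite /excess max_l; last by rewrite subr_ge0.
rewrite -d3 -(mean_root_exp_gt_cst d0 d1); apply: eq_Rintegral => w _.
by rewrite -(cube_lt (ltW d0) (ltW (V_pos w))) d3 ltr_pdivrMr.
Qed.

Let excess_pos c delta w : 0 < c -> 0 < delta -> delta ^+ 3 = c ->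
  excess (V w ^+ 3) c = (1 - V w ^+ 3 / c) * (V w < delta)%R%:R.
Proof.
move=> c0 d0 d3; rewrite /excess -(cube_lt (ltW (V_pos w)) (ltW d0)) d3.
case: ltP => h; first by rewrite mulr1 max_l// subr_ge0 ler_pdivrMr// mul1r ltW.
by rewrite mulr0 max_r// subr_le0 ler_pdivlMr// mul1r.
Qed.

(** For uniform W = V^3 this is the integral of (1 - w / c)^2 over [0, c]. *)
Lemma mean_excess_sqr1 c : 0 < c -> c <= 1 ->
  \int[P]_w excess (V w ^+ 3) c ^+ 2 = c / 3%:R.
Proof.
move=> c0 c1; have [delta [d0 d1 d3]] := cube_rootP c0 c1.
pose U k w := V w ^+ k * (V w < delta)%R%:R.
have bU k : bmeas (U k).
  by apply: bmeasM; [apply: bmeasX; exact: bmeas_root_exp|exact: bmeas_lt].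
have -> : \int[P]_w excess (V w ^+ 3) c ^+ 2 =
    \int[P]_w (U 0 w - 2%:R / c * U 3 w + (c^-1) ^+ 2 * U 6 w).
  apply: eq_Rintegral => w _; rewrite (excess_pos w c0 d0 d3) /U.
  case: (V w < delta); last by rewrite !mulr0 expr0n/= subr0 addr0.
  by rewrite !mulr1; field; rewrite gt_eqF.
rewrite (meanD P (bmeasB (bU 0%N) (bmeasZ _ (bU 3%N))) (bmeasZ _ (bU 6%N))).
rewrite (meanB P (bU 0%N) (bmeasZ _ (bU 3%N))).
rewrite (meanZ P _ (bU 3%N)) (meanZ P _ (bU 6%N)).
rewrite !mean_root_exp_pow_lt// -d3.
by field; rewrite gt_eqF.
Qed.

(** Against the density, 3 v^2 (1 - D / v)^2 = 3 (v - D)^2 has the primitive (v - D)^3; the excess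
    vanishes below v = D, which is therefore the cut. *)
Lemma mean_excess_sqr2 D : 0 < D -> D <= 1 ->
  \int[P]_w excess D (V w) ^+ 2 = (1 - D) ^+ 3.
Proof.
move=> D0 D1.
have ge0 (v : R) : 0 < v -> v <= 1 -> 0 <= (1 - D / v) ^+ 2.
  by move=> _ _; exact: sqr_ge0.
have cc (v : R) : 0 < v -> {for v, continuous (fun v : R => (1 - D / v) ^+ 2)}.
  move=> v0; apply: (@continuous_comp R R R (fun v : R => 1 - D / v) (fun y : R => y ^+ 2)).
    apply: continuousB; first exact: cst_continuous.
    apply: continuousM; first exact: cst_continuous.
    by apply: continuousV; [rewrite gt_eqF|exact: cvg_id].
  exact: exprn_continuous.
have dd (v : R) : 0 < v -> is_derive v (1 : R) (fun v : R => (v - D) ^+ 3)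
    (3%:R * v ^+ 2 * (1 - D / v) ^+ 2).
  move=> v0.
  have h1 : is_derive v (1 : R) (fun v : R => v - D) 1.
    have h := is_deriveB (@is_derive_id _ _ v (1 : R)) (@is_derive_cst _ _ _ D v (1 : R)).
    by apply: is_derive_eq h _; rewrite subr0.
  have h3 := @is_derive1_comp _ (fun x : R => 1 * x ^+ 3) (fun v : R => v - D) v _ _
    (is_derive_powZ 2 1 _) h1.
  have -> : (fun v : R => (v - D) ^+ 3) = (fun x : R => 1 * x ^+ 3) \o (fun v : R => v - D).
    by apply/funext => x /=; rewrite mul1r.
  by apply: is_derive_eq h3 _; field; rewrite gt_eqF.
have := mean_root_exp_gt lambda0 lawX ge0 cc dd D0 D1.
rewrite subrr (expr0n _ 3) subr0 => <-.
apply: eq_Rintegral => w _; rewrite /excess -/(V w).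
case: ltP => h; first by rewrite mulr1 max_l// subr_ge0 ler_pdivrMr// mul1r ltW.
rewrite mulr0 max_r; first by rewrite expr0n.
by rewrite subr_le0 ler_pdivlMr// mul1r.
Qed.

(** For uniform W = V^3 this is the integral of 1 - w / c over [0, A c], on which the excess is
    positive because A <= 1. *)
Lemma mean_excess_beats A c : 0 < A -> A <= 1 -> 0 < c -> c <= 1 ->
  \int[P]_w (excess (V w ^+ 3) c * (V w ^+ 3 < A * c)%R%:R) = c * (A - A ^+ 2 / 2%:R).
Proof.
move=> A0 A1 c0 c1; have Ac0 : 0 < A * c by exact: mulr_gt0.
have Ac1 : A * c <= 1 by apply: mulr_ile1 => //; exact: ltW.
have [delta [d0 d1 d3]] := cube_rootP Ac0 Ac1.
pose U k w := V w ^+ k * (V w < delta)%R%:R.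
have bU k : bmeas (U k).
  by apply: bmeasM; [apply: bmeasX; exact: bmeas_root_exp|exact: bmeas_lt].
have -> : \int[P]_w (excess (V w ^+ 3) c * (V w ^+ 3 < A * c)%R%:R) =
    \int[P]_w (U 0 w - c^-1 * U 3 w).
  apply: eq_Rintegral => w _; rewrite /U -(cube_lt (ltW (V_pos w)) (ltW d0)) d3.
  case: ltP => h; last by rewrite !mulr0 subr0.
  rewrite !mulr1 /excess max_l ?expr0; first by rewrite mulrC.
  rewrite subr_ge0 ler_pdivrMr// mul1r; apply: le_trans (ltW h) _.
  by rewrite ler_piMl// ltW.
rewrite (meanB P (bU 0%N) (bmeasZ _ (bU 3%N))) (meanZ P _ (bU 3%N)) !mean_root_exp_pow_lt//.
rewrite (_ : delta ^+ 6 = (A * c) ^+ 2); last by rewrite -d3; ring.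
by rewrite d3; field; rewrite gt_eqF.
Qed.

End root_exp_law.

(** * The statistic as a fourfold average *)

Section averages.
Context {R : realFieldType}.
Implicit Types (n : nat).

Definition avg n (f : nat -> R) : R := n%:R^-1 * \sum_(i < n) f i.

Lemma eq_avg n (f g : nat -> R) : (forall i, f i = g i) -> avg n f = avg n g.
Proof. by move=> fg; congr (_ * _); apply: eq_bigr => i _. Qed.

Lemma eq_avg_lt n (f g : nat -> R) :
  (forall i, (i < n)%N -> f i = g i) -> avg n f = avg n g.
Proof. by move=> fg; congr (_ * _); apply: eq_bigr => i _; exact: fg. Qed.

Lemma avg_cst n (r : R) : (0 < n)%N -> avg n (fun=> r) = r.
Proof.
move=> n0; rewrite /avg sumr_const card_ord -[r *+ n]mulr_natl mulKf//.
by rewrite pnatr_eq0 -lt0n.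
Qed.

Lemma avgD n (f g : nat -> R) : avg n (fun i => f i + g i) = avg n f + avg n g.
Proof. by rewrite /avg big_split/= mulrDr. Qed.

Lemma avgZ n (r : R) (f : nat -> R) : avg n (fun i => r * f i) = r * avg n f.
Proof. by rewrite /avg -mulr_sumr mulrCA. Qed.

Lemma avgB n (f g : nat -> R) : avg n (fun i => f i - g i) = avg n f - avg n g.
Proof. by rewrite /avg sumrB mulrBr. Qed.

Lemma avg_swap n (f : nat -> nat -> R) :
  avg n (fun i => avg n (f i)) = avg n (fun j => avg n (f ^~ j)).
Proof.
rewrite /avg; congr (_ * _); rewrite -!mulr_sumr; congr (_ * _).
exact: exchange_big.
Qed.

Lemma le_avg n (f g : nat -> R) : (forall i, f i <= g i) -> avg n f <= avg n g.
Proof.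
by move=> fg; apply: ler_wpM2l; rewrite ?invr_ge0 ?ler0n//; apply: ler_sum.
Qed.

Lemma avg4E n (f : nat -> nat -> nat -> nat -> R) :
  avg n (fun k => avg n (fun l => avg n (fun i => avg n (fun j => f k l i j)))) =
  (n%:R ^+ 4)^-1 * \sum_(k < n) \sum_(l < n) \sum_(i < n) \sum_(j < n) f k l i j.
Proof.
rewrite /avg; under eq_bigr do under eq_bigr do rewrite -mulr_sumr.
under eq_bigr do rewrite -!mulr_sumr.
by rewrite -!mulr_sumr -exprVn !exprS expr0 mulr1 !mulrA.
Qed.

End averages.

Lemma bmeas_avg d (T : measurableType d) (R : realType) n (f : nat -> T -> R) :
  (forall i, bmeas (f i)) -> bmeas (fun w => avg n (fun i => f i w)).
Proof. by move=> bf; apply: bmeasZ; exact: bmeas_sum. Qed.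

Lemma mean_avg d (T : measurableType d) (R : realType) (P : probability T R) n
    (f : nat -> T -> R) : (forall i, bmeas (f i)) ->
  \int[P]_w avg n (fun i => f i w) = avg n (fun i => \int[P]_w f i w).
Proof.
move=> bf; rewrite /avg [LHS]meanZ; last exact: bmeas_sum.
by rewrite mean_sum.
Qed.

(** * The strict minimum of four numbers *)

Section strict_minimum.
Context {R : realType}.
Implicit Types a b c e : R.

Definition smin a b c e : bool := [&& e < a, e < b & e < c].

Definition ties a b c e : R := (a == b)%:R + (a == c)%:R + (a == e)%:R +
  (b == c)%:R + (b == e)%:R + (c == e)%:R.

Lemma smin_rot_le1 a b c e : (smin a b c e)%:R + (smin b c e a)%:R +
  (smin c e a b)%:R + (smin e a b c)%:R <= 1 :> R.
Proof.
rewrite -!natrD -[leRHS]/(1%:R) ler_nat /smin.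
case: (boolP [&& e < a, e < b & e < c]) => [/and3P[ea eb ec]|_].
  by rewrite (lt_gtF ea) (lt_gtF eb) (lt_gtF ec) !(andbF, andFb).
case: (boolP [&& a < b, a < c & a < e]) => [/and3P[ab ac ae]|_].
  by rewrite (lt_gtF ab) (lt_gtF ac) !(andbF, andFb).
case: (boolP [&& b < c, b < e & b < a]) => [/and3P[bc be ba]|_].
  by rewrite (lt_gtF bc) !(andbF, andFb).
by case: (_ && _).
Qed.

Lemma smin_rot_ge a b c e : 1 - ties a b c e <= (smin a b c e)%:R +
  (smin b c e a)%:R + (smin c e a b)%:R + (smin e a b c)%:R :> R.
Proof.
rewrite lerBlDl /ties -!natrD -[leLHS]/(1%:R) ler_nat.
case: (boolP [|| a == b, a == c, a == e, b == c, b == e | c == e]).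
  by case: (a == b); case: (a == c); case: (a == e); case: (b == c);
    case: (b == e); case: (c == e).
rewrite !negb_or => /and5P[ab ac ae bc /andP[be ce]].
suff : [|| smin a b c e, smin b c e a, smin c e a b | smin e a b c].
  by case: (smin a b c e); case: (smin b c e a); case: (smin c e a b);
    case: (smin e a b c); rewrite ?addn0 ?addnS.
rewrite /smin.
(* A knockout: the smaller of a and b meets the smaller of c and e. *)
case: (ltgtP a b) ab => // ab _; case: (ltgtP c e) ce => // ce _.
- case: (ltgtP a c) ac => // ac _; first by rewrite (lt_trans ac ce) !orbT.
  by rewrite (lt_trans ac ab) !orbT.
- case: (ltgtP a e) ae => // ae _; first by rewrite (lt_trans ae ce) !orbT.
  by rewrite (lt_trans ae ab).
- case: (ltgtP b c) bc => // bc _; first by rewrite (lt_trans bc ce) !orbT.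
  by rewrite (lt_trans bc ab) !orbT.
- case: (ltgtP b e) be => // be _; first by rewrite (lt_trans be ce) !orbT.
  by rewrite (lt_trans be ab).
Qed.

End strict_minimum.

Section statistic.
Context {R : realType}.
Variable (n : nat).
Hypothesis n0 : (0 < n)%N.
Variable (v : nat -> R).
Local Notation M := (avg n).

Lemma avg_rot (f : nat -> nat -> nat -> nat -> R) :
  M (fun l => M (fun i => M (fun j => M (fun k => f i j k l)))) =
  M (fun l => M (fun i => M (fun j => M (fun k => f l i j k)))).
Proof.
rewrite avg_swap; apply: eq_avg => i.
rewrite avg_swap; apply: eq_avg => j.
by rewrite avg_swap.
Qed.

Definition tie_rate : R := M (fun i => M (fun j => (v i == v j)%:R : R)).

Definition smin_rate : R := M (fun l => M (fun i => M (fun j => M (fun k =>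
  (smin (v i) (v j) (v k) (v l))%:R)))).

(* Averaging over the four rotations of the indices: when the four values are distinct,
   exactly one rotation puts the minimum last. *)
Lemma smin_rate_bound : `|smin_rate - 1 / 4%:R| <= 3%:R / 2%:R * tie_rate.
Proof.
pose A4 (f : nat -> nat -> nat -> nat -> R) :=
  M (fun l => M (fun i => M (fun j => M (fun k => f l i j k)))).
have A4D f g : A4 (fun l i j k => f l i j k + g l i j k) = A4 f + A4 g.
  rewrite /A4 -avgD; apply: eq_avg => l; rewrite -avgD; apply: eq_avg => i.
  by rewrite -avgD; apply: eq_avg => j; rewrite -avgD.
have A4c (r : R) : A4 (fun _ _ _ _ => r) = r by rewrite /A4 !avg_cst.
have A4B f g : A4 (fun l i j k => f l i j k - g l i j k) = A4 f - A4 g.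
  rewrite /A4 -avgB; apply: eq_avg => l; rewrite -avgB; apply: eq_avg => i.
  by rewrite -avgB; apply: eq_avg => j; rewrite -avgB.
have le_A4 f g : (forall l i j k, f l i j k <= g l i j k) -> A4 f <= A4 g.
  by move=> fg; do 4 (apply: le_avg => ?).
pose s l i j k : R := (smin (v i) (v j) (v k) (v l))%:R.
have E : A4 (fun l i j k => s l i j k + s i j k l + s j k l i + s k l i j) = 4%:R * smin_rate.
  have r1 : A4 (fun l i j k => s i j k l) = smin_rate by rewrite /A4 avg_rot.
  have r2 : A4 (fun l i j k => s j k l i) = smin_rate.
    by rewrite -r1 /A4 -(avg_rot (fun l i j k => s i j k l)).
  have r3 : A4 (fun l i j k => s k l i j) = smin_rate.
    by rewrite -r2 /A4 -(avg_rot (fun l i j k => s j k l i)).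
  rewrite !A4D r1 r2 r3 -/smin_rate (_ : A4 s = smin_rate)//; ring.
(* Each of the six pairs averages to [tie_rate]; divided by the four rotations this is the constant
   3/2. *)
have T : A4 (fun l i j k => ties (v i) (v j) (v k) (v l)) = 6%:R * tie_rate.
  rewrite /ties !A4D.
  have -> : A4 (fun l i j k => (v i == v j)%:R : R) = tie_rate.
    rewrite /A4 avg_cst//; apply: eq_avg => i; apply: eq_avg => j.
    by rewrite avg_cst.
  have -> : A4 (fun l i j k => (v i == v k)%:R : R) = tie_rate.
    by rewrite /A4 avg_cst//; apply: eq_avg => i; rewrite avg_cst.
  have -> : A4 (fun l i j k => (v i == v l)%:R : R) = tie_rate.
    rewrite /A4 avg_swap; apply: eq_avg => i; apply: eq_avg => l.
    by rewrite !avg_cst.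
  have -> : A4 (fun l i j k => (v j == v k)%:R : R) = tie_rate.
    by rewrite /A4 !avg_cst.
  have -> : A4 (fun l i j k => (v j == v l)%:R : R) = tie_rate.
    transitivity (M (fun l => M (fun j => (v j == v l)%:R : R))).
      apply: eq_avg => l; rewrite avg_cst//; apply: eq_avg => j.
      by rewrite avg_cst.
    by rewrite avg_swap.
  have -> : A4 (fun l i j k => (v k == v l)%:R : R) = tie_rate.
    transitivity (M (fun l => M (fun k => (v k == v l)%:R : R))).
      by apply: eq_avg => l; rewrite !avg_cst.
    by rewrite avg_swap.
  ring.
have up : 4%:R * smin_rate <= 1.
  by rewrite -E -[leRHS]A4c; apply: le_A4 => l i j k; exact: smin_rot_le1.
have lo : 1 - 6%:R * tie_rate <= 4%:R * smin_rate.
  by rewrite -E -T -[X in X - _]A4c -A4B; apply: le_A4 => l i j k; exact: smin_rot_ge.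
have t0 : 0 <= tie_rate.
  rewrite /tie_rate -[leLHS](avg_cst _ n0); apply: le_avg => i.
  by rewrite -[leLHS](avg_cst _ n0); apply: le_avg => j.
by rewrite ler_norml; apply/andP; split; lra.
Qed.

End statistic.

Section statistic_root_exp.
Context {R : realType}.
Variables (lambda : R) (lambda0 : 0 < lambda) (n : nat) (n0 : (0 < n)%N).
Local Notation M := (avg n).

Definition beats (a c e : R) : bool := e ^+ 3 < a ^+ 3 * c.

(** A maximum is below a bound when both its arguments are, so the indicator in G_n is a product.
    With k and l outermost, the averages over i and j form the square of one proportion. *)
Definition beat_rate (v : nat -> R) : R := M (fun k => M (fun l =>
  M (fun i => M (fun j => (beats (v i) (v k) (v l))%:R * (beats (v j) (v k) (v l))%:R)))).

Lemma root_exp_lt (x y : R) : 0 <= x -> 0 <= y ->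
  (root_exp lambda x < root_exp lambda y) = (y < x).
Proof.
move=> x0 y0; rewrite /root_exp !ger0_norm// ltr_expR !mulNr ltrN2.
by rewrite ltr_pM2l// divr_gt0.
Qed.

Lemma beats_root_exp (x y z : R) : 0 <= x -> 0 <= y -> 0 <= z ->
  beats (root_exp lambda x) (root_exp lambda y) (root_exp lambda z) =
  (x + y / 3%:R < z).
Proof.
move=> x0 y0 z0; rewrite /beats /root_exp !ger0_norm//.
rewrite -!expRM_natl -expRD ltr_expR.
rewrite (_ : 3%:R * (- (lambda / 3%:R) * z) = - (lambda * z)); last by field.
rewrite (_ : _ + _ = - (lambda * (x + y / 3%:R))); last by field.
by rewrite ltrN2 ltr_pM2l.
Qed.

(** The three summands of [Gn] are relabellings of one another and have equal averages, which
    absorbs the factor 1/3. The identity is exact, ties included. *)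
Lemma Istat_root_exp (x : nat -> R) : (forall i, (i < n)%N -> 0 <= x i) ->
  Istat x n = smin_rate n (fun i => root_exp lambda (x i)) -
              beat_rate (fun i => root_exp lambda (x i)).
Proof.
move=> x0; set v := fun i => _; rewrite Istat_sum_ge0E//.
have nR : n%:R != 0 :> R by rewrite pnatr_eq0 -lt0n.
pose K i j k l : R := (Num.max (x i) (x j) + x k / 3%:R < x l)%R%:R.
have KE i j k l : (i < n)%N -> (j < n)%N -> (k < n)%N -> (l < n)%N ->
    K i j k l = (beats (v i) (v k) (v l))%:R * (beats (v j) (v k) (v l))%:R.
  move=> ? ? ? ?; rewrite -natrM mulnb /K /v !beats_root_exp ?x0//.
  by rewrite -ltrBrDr gt_max !ltrBrDr.
pose A3 (f : nat -> nat -> nat -> R) := M (fun i => M (fun j => M (fun k => f i j k))).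
have A3E f : A3 f = (n%:R ^+ 3)^-1 * \sum_(i < n) \sum_(j < n) \sum_(k < n) f i j k.
  rewrite /A3 /avg; under eq_bigr do rewrite -mulr_sumr.
  by rewrite -!mulr_sumr; field.
have HE l : (l < n)%N ->
    Hn x n (x l) = A3 (fun i j k => (smin (v i) (v j) (v k) (v l))%:R).
  move=> ln; rewrite A3E /Hn; congr (_ * _).
  do 3 (apply: eq_bigr => ? _); rewrite !gt_max /smin /v !root_exp_lt ?x0//.
  by rewrite andbA.
have GE l : (l < n)%N -> Gn x n (x l) = 3%:R^-1 *
    (A3 (fun i j k => K i j k l) + A3 (fun i j k => K j k i l) + A3 (fun i j k => K k i j l)).
  move=> ln; rewrite !A3E /Gn invfM -mulrA; congr (_ * _).
  rewrite -!mulrDr; congr (_ * _); rewrite -!big_split/=; apply: eq_bigr => i _.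
  by rewrite -!big_split/=; apply: eq_bigr => j _; rewrite -!big_split.
have A3rot f : A3 (fun i j k => f j k i) = A3 f.
  by rewrite /A3 avg_swap; apply: eq_avg => j; rewrite avg_swap.
transitivity (M (fun l => Hn x n (x l) - Gn x n (x l))) => //.
rewrite avgB; congr (_ - _).
  by rewrite /smin_rate; apply: eq_avg_lt => l ln; rewrite HE.
transitivity (M (fun l => A3 (fun i j k => K i j k l))).
  apply: eq_avg_lt => l ln; rewrite GE//.
  rewrite (A3rot (fun i j k => K i j k l)) (_ : A3 (fun i j k => K k i j l) =
    A3 (fun i j k => K i j k l)); first by field.
  by rewrite -(A3rot (fun i j k => K k i j l)).
rewrite /A3 /beat_rate.
transitivity (M (fun l => M (fun k => M (fun i => M (fun j => K i j k l))))).
  by apply: eq_avg => l; exact: esym (A3rot (fun i j k => K i j k l)).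
rewrite avg_swap; do 4 (apply: eq_avg_lt => ? ?).
exact: KE.
Qed.

End statistic_root_exp.

Section bmeas_rates.
Context d (T : measurableType d) (R : realType) (V : nat -> T -> R) (n : nat).
Hypothesis bV : forall i, bmeas (V i).

Lemma bmeas_smin_rate : bmeas (fun w => smin_rate n (fun i => V i w)).
Proof.
do 4 (apply: bmeas_avg => ?); rewrite /smin; under eq_fun do rewrite -!mulnb !natrM.
by do 2 ?apply: bmeasM; apply: bmeas_lt; exact: (bV _).1.
Qed.

Lemma bmeas_beat_rate : bmeas (fun w => beat_rate n (fun i => V i w)).
Proof.
have bB k l i : bmeas (fun w => (beats (V i w) (V k w) (V l w))%:R : R).
  apply: bmeas_lt; first by have [] := bmeasX 3 (bV l).
  by have [] := bmeasM (bmeasX 3 (bV i)) (bV k).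
by do 4 (apply: bmeas_avg => ?); exact: bmeasM.
Qed.

End bmeas_rates.

(** * Linearisation of the statistic *)

Section remainder.
Context d (T : measurableType d) (R : realType) (P : probability T R).
Variables (lambda : R) (lambda0 : 0 < lambda) (X : nat -> {RV P >-> R}).
Hypothesis indepX : independent_RVs P X.
Hypothesis lawX : forall i, has_law P (X i) (exponential_prob lambda).

Let V i w := root_exp lambda (X i w).

Let V_pos i w : 0 < V i w. Proof. exact: expR_gt0. Qed.

Let V_le1 i w : V i w <= 1.
Proof.
by rewrite /V /root_exp -expR0 ler_expR mulNr oppr_le0 mulr_ge0// divr_ge0// ltW.
Qed.

Let mV i : measurable_fun setT (V i).
Proof. by have [] := bmeas_root_exp lambda0 (X i). Qed.

Let bV i : bmeas (V i). Proof. exact: bmeas_root_exp. Qed.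

Lemma indep_root_exp (J : seq nat) (B : nat -> set R) : uniq J ->
  (forall i, measurable (B i)) ->
  P (\bigcap_(i in [set` J]) (V i @^-1` B i)) =
  (\prod_(i <- J) P (V i @^-1` B i))%E.
Proof.
move=> uJ mB; apply: (indepX (B := fun i => root_exp lambda @^-1` B i)) => // i.
rewrite -[X in measurable X]setTI.
exact: (continuous_measurable_fun (@continuous_root_exp _ lambda)).
Qed.

Let unit_itv : set R := [set x | 0 < x <= 1].

Let V_unit i w : unit_itv (V i w).
Proof. by rewrite /unit_itv/= V_pos V_le1. Qed.

Local Notation avgV4 g n w := (avg n (fun k => avg n (fun l => avg n (fun i =>
  avg n (fun j => g (V i w, V j w, V k w, V l w)))))).

Let bavg4 (g : R * R * R * R -> R) n : bmeas g -> bmeas (fun w => avgV4 g n w).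
Proof. by move=> bg; do 4 (apply: bmeas_avg => ?); apply: bmeas_quad. Qed.

(* |y| <= n y^2 / 2 + 1 / (2 n) replaces the Cauchy-Schwarz inequality. *)
Lemma canonical_mean_abs (g : R * R * R * R -> R) : bmeas g ->
  (forall i y z t, unit_itv y -> unit_itv z -> unit_itv t ->
    \int[P]_w g (V i w, y, z, t) = 0) ->
  (forall i x z t, unit_itv x -> unit_itv z -> unit_itv t ->
    \int[P]_w g (x, V i w, z, t) = 0) ->
  exists2 C, 0 <= C & forall n, (0 < n)%N ->
    \int[P]_w `|avgV4 g n w| <= C / n%:R.
Proof.
move=> bg g1 g2; have [mg [M gM]] := bg.
exists ((20%:R * M ^+ 2 + 1) / 2%:R).
  by rewrite divr_ge0// addr_ge0// mulr_ge0// sqr_ge0.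
move=> n n0; have nR : 0 < n%:R :> R by rewrite ltr0n.
have b1 := bavg4 n bg; have b2 := bmeasX 2 b1.
have H : \int[P]_w (avgV4 g n w) ^+ 2 <= 20%:R * M ^+ 2 / n%:R ^+ 2.
  have := canonical_second_moment mV indep_root_exp V_unit mg gM g1 g2 n.
  by under eq_Rintegral => w _ do
    rewrite -(avg4E n (fun k l i j => g (V i w, V j w, V k w, V l w))).
pose r (w : T) := n%:R / 2%:R * avgV4 g n w ^+ 2 + 1 / (2%:R * n%:R).
have br : bmeas r by apply: bmeasD; [exact: bmeasZ|exact: bmeas_cst].
apply: (@le_trans _ _ (\int[P]_w r w)).
  apply: le_mean => //; first exact: bmeas_norm.
  move=> w; rewrite /r; move: (avgV4 g n w) => y.
  rewrite -subr_ge0 -(real_normK (num_real y)).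
  rewrite (_ : _ - _ = n%:R / 2%:R * (`|y| - n%:R^-1) ^+ 2).
    by rewrite mulr_ge0 ?sqr_ge0// divr_ge0// ltW.
  by field; rewrite gt_eqF.
rewrite /r (meanD P (bmeasZ _ b2) (bmeas_cst _ _)) (meanZ P _ b2) mean_cst.
apply: (@le_trans _ _ (n%:R / 2%:R * (20%:R * M ^+ 2 / n%:R ^+ 2) + 1 / (2%:R * n%:R))).
  by rewrite lerD2r ler_wpM2l// divr_ge0// ltW.
by rewrite le_eqVlt; apply/orP; left; apply/eqP; field; rewrite gt_eqF.
Qed.

(* Clamping to [0, 1] makes the kernels below bounded on the whole of R. *)
Let cl (x : R) := Num.min (Num.max x 0) 1.

Let clE x : unit_itv x -> cl x = x.
Proof. by move=> /andP[x0 x1]; rewrite /cl (max_l (ltW x0)) min_l. Qed.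

Let clV i w : cl (V i w) = V i w. Proof. exact: clE. Qed.

Let cl_ge0 x : 0 <= cl x.
Proof. by rewrite /cl le_min ler01 andbT le_max lexx orbT. Qed.

Let cl_le1 x : cl x <= 1. Proof. by rewrite /cl ge_min lexx orbT. Qed.

Let bcl d' (S : measurableType d') (a : S -> R) : measurable_fun setT a ->
  bmeas (fun s => cl (a s)).
Proof.
move=> ma; apply: (@bmeasP _ _ _ _ 1); last by move=> s; rewrite ger0_norm.
by apply: measurable_minr => //; exact: measurable_maxr.
Qed.

Let F (c e : R) : R := excess (cl e ^+ 3) (cl c).

Let b (a c e : R) : R := (beats (cl a) (cl c) (cl e))%:R.

(** By [EFb] and [EF1], c q(a) is what remains of F(c, e) b(a, c, e) - F(c, e)^2 when e is
    integrated out. *)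
Let q (a : R) : R := cl a ^+ 3 - cl a ^+ 6 / 2%:R - 3%:R^-1.

Let bF d' (S : measurableType d') (c e : S -> R) : measurable_fun setT c ->
  measurable_fun setT e -> bmeas (fun s => F (c s) (e s)).
Proof.
move=> mc me; apply: (@bmeasP _ _ _ _ 1); last first.
  move=> s; rewrite ger0_norm ?excess_ge0// excess_le1// divr_ge0// exprn_ge0//.
apply: measurable_maxr => //; apply: measurable_funB => //.
apply: measurable_funM; first by have [] := bmeasX 3 (bcl me).
(* The inverse is exp (- ln) on positive reals, and the indicator factor reproduces its default
   value 0 at 0. *)
have -> : (fun s => (cl (c s))^-1) =
    (fun s => (0 < cl (c s))%R%:R * expR (- ln (cl (c s)))).
  apply/funext => s; have := cl_ge0 (c s); rewrite le_eqVlt => /predU1P[<-|c0].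
    by rewrite invr0 ltxx mul0r.
  by rewrite c0 mul1r expRN lnK.
apply: measurable_funM.
  have [] // : bmeas (fun s => (0 < cl (c s))%R%:R : R).
  by apply: bmeas_lt; [exact: measurable_cst|exact: (bcl mc).1].
apply: measurableT_comp => //; apply: measurableT_comp => //.
by apply: (measurableT_comp (@measurable_ln R)); exact: (bcl mc).1.
Qed.

Let bb d' (S : measurableType d') (a c e : S -> R) : measurable_fun setT a ->
  measurable_fun setT c -> measurable_fun setT e ->
  bmeas (fun s => b (a s) (c s) (e s)).
Proof.
move=> ma mc me; apply: bmeas_lt; first by have [] := bmeasX 3 (bcl me).
by have [] := bmeasM (bmeasX 3 (bcl ma)) (bcl mc).
Qed.

Let bq d' (S : measurableType d') (a : S -> R) : measurable_fun setT a ->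
  bmeas (fun s => q (a s)).
Proof.
move=> ma; apply: bmeasB; last exact: bmeas_cst.
apply: bmeasB; first by apply: bmeasX; exact: bcl.
by apply: bmeasM; [apply: bmeasX; exact: bcl|exact: bmeas_cst].
Qed.

Let Eb i c e : unit_itv c -> unit_itv e -> \int[P]_w b (V i w) c e = F c e.
Proof.
move=> uc ue; have [c0 c1] := andP uc; have [e0 e1] := andP ue.
rewrite /F !clE// -(mean_beats lambda0 (lawX i) (exprn_gt0 3 e0) c0 c1).
by apply: eq_Rintegral => w _; rewrite /b clV !clE.
Qed.

Let EF1 i c : unit_itv c -> \int[P]_w F c (V i w) ^+ 2 = c / 3%:R.
Proof.
move=> uc; have [c0 c1] := andP uc; rewrite -(mean_excess_sqr1 lambda0 (lawX i) c0 c1).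
by apply: eq_Rintegral => w _; rewrite /F clV clE.
Qed.

Let EF2 i e : unit_itv e -> \int[P]_w F (V i w) e ^+ 2 = (1 - e ^+ 3) ^+ 3.
Proof.
move=> ue; have [e0 e1] := andP ue.
rewrite -(mean_excess_sqr2 lambda0 (lawX i) (exprn_gt0 3 e0) (exprn_ile1 3 (ltW e0) e1)).
by apply: eq_Rintegral => w _; rewrite /F clV clE.
Qed.

Let EFb i a c : unit_itv a -> unit_itv c ->
  \int[P]_w (F c (V i w) * b a c (V i w)) = c * (a ^+ 3 - a ^+ 6 / 2%:R).
Proof.
move=> ua uc; have [a0 a1] := andP ua; have [c0 c1] := andP uc.
rewrite (exprM a 3 2) -(mean_excess_beats lambda0 (lawX i)
  (exprn_gt0 3 a0) (exprn_ile1 3 (ltW a0) a1) c0 c1).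
by apply: eq_Rintegral => w _; rewrite /F /b clV !clE.
Qed.

Let Epow i k : \int[P]_w V i w ^+ k = 3%:R / k.+3%:R.
Proof. exact: (mean_root_exp_pow lambda0 (lawX i)). Qed.

Let Eq i : \int[P]_w q (V i w) = 0.
Proof.
have -> : \int[P]_w q (V i w) = \int[P]_w (V i w ^+ 3 - 2%:R^-1 * V i w ^+ 6 - 3%:R^-1).
  by apply: eq_Rintegral => w _; rewrite /q clV mulrC.
have b3 := bmeasX 3 (bV i); have b6 := bmeasZ 2%:R^-1 (bmeasX 6 (bV i)).
rewrite (meanB P (bmeasB b3 b6) (bmeas_cst _ _)) (meanB P b3 b6).
rewrite (meanZ P _ (bmeasX 6 (bV i))) !Epow mean_cst.
by field.
Qed.

(** In all four kernels the first two slots hold the centred arguments. Here they are c and e: this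
    is F^2 minus its two conditional expectations plus its mean 1/4. *)
Let g1 (p : R * R * R * R) : R := F p.1.1.1 p.1.1.2 ^+ 2 - cl p.1.1.1 / 3%:R -
  (1 - cl p.1.1.2 ^+ 3) ^+ 3 + 4%:R^-1.

(** The cross term F (b - F), centred in a (slot 1) and e (slot 2) with c (slot 3) as parameter.
    Subtracting c q(a) centres it in e. *)
Let g2 (p : R * R * R * R) : R := F p.1.2 p.1.1.2 * b p.1.1.1 p.1.2 p.1.1.2 -
  F p.1.2 p.1.1.2 ^+ 2 - cl p.1.2 * q p.1.1.1.

(** The term c q(a) set aside in [g2] is replaced by its linear part E(V) q(a), with E(V) = 3/4. *)
Let g3 (p : R * R * R * R) : R := (cl p.1.1.2 - 3%:R / 4%:R) * q p.1.1.1.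

(** Polarised form of (U - F)^2: given c and e (slots 3 and 4) the two factors are centred
    separately. *)
Let g4 (p : R * R * R * R) : R := (b p.1.1.1 p.1.2 p.2 - F p.1.2 p.2) *
  (b p.1.1.2 p.1.2 p.2 - F p.1.2 p.2).

Let mp1 : measurable_fun setT (fun p : R * R * R * R => p.1.1.1).
Proof. by do 2 apply: measurableT_comp => //. Qed.
Let mp2 : measurable_fun setT (fun p : R * R * R * R => p.1.1.2).
Proof. by do 2 apply: measurableT_comp => //. Qed.
Let mp3 : measurable_fun setT (fun p : R * R * R * R => p.1.2).
Proof. by apply: measurableT_comp => //. Qed.
Let mp4 : measurable_fun setT (fun p : R * R * R * R => p.2).
Proof. exact: measurable_snd. Qed.

Let bg1 : bmeas g1.
Proof.
apply: bmeasD; last exact: bmeas_cst.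
apply: bmeasB; last by apply: bmeasX; apply: bmeasB; [exact: bmeas_cst|
  apply: bmeasX; exact: bcl].
by apply: bmeasB; [apply: bmeasX; exact: bF|apply: bmeasM; [exact: bcl|exact: bmeas_cst]].
Qed.

Let bg2 : bmeas g2.
Proof.
apply: bmeasB; last by apply: bmeasM; [exact: bcl|exact: bq].
by apply: bmeasB; [apply: bmeasM; [exact: bF|exact: bb]|apply: bmeasX; exact: bF].
Qed.

Let bg3 : bmeas g3.
Proof.
apply: bmeasM; last exact: bq.
by apply: bmeasB; [exact: bcl|exact: bmeas_cst].
Qed.

Let bg4 : bmeas g4.
Proof. by apply: bmeasM; apply: bmeasB; do ?[exact: bF|exact: bb]. Qed.

Let bFVc i c : bmeas (fun w => F (V i w) c). Proof. exact: bF. Qed.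
Let bFcV i c : bmeas (fun w => F c (V i w)). Proof. exact: bF. Qed.
Let bbV i c e : bmeas (fun w => b (V i w) c e). Proof. exact: bb. Qed.
Let bqV i : bmeas (fun w => q (V i w)). Proof. exact: bq. Qed.

Let g1_canonical1 i y z t : unit_itv y -> unit_itv z -> unit_itv t ->
  \int[P]_w g1 (V i w, y, z, t) = 0.
Proof.
move=> uy _ _.
have b1 : bmeas (fun w => F (V i w) y ^+ 2) by exact: bmeasX.
have b2 : bmeas (fun w => 3%:R^-1 * V i w ^+ 1) by apply: bmeasZ; exact: bmeasX.
have -> : \int[P]_w g1 (V i w, y, z, t) = \int[P]_w (F (V i w) y ^+ 2 -
    3%:R^-1 * V i w ^+ 1 - ((1 - y ^+ 3) ^+ 3 - 4%:R^-1)).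
  by apply: eq_Rintegral => w _; rewrite /g1/= clV clE//; ring.
rewrite (meanB P (bmeasB b1 b2) (bmeas_cst _ _)) (meanB P b1 b2).
rewrite (meanZ P _ (bmeasX 1 (bV i))) Epow EF2// mean_cst.
by field.
Qed.

Let g1_canonical2 i x z t : unit_itv x -> unit_itv z -> unit_itv t ->
  \int[P]_w g1 (x, V i w, z, t) = 0.
Proof.
move=> ux _ _.
have b1 : bmeas (fun w => F x (V i w) ^+ 2) by exact: bmeasX.
have b3 k : bmeas (fun w => V i w ^+ k) by exact: bmeasX.
have b2 : bmeas (fun w => 3%:R * V i w ^+ 3 - 3%:R * V i w ^+ 6 + V i w ^+ 9).
  by apply: bmeasD => //; apply: bmeasB; exact: bmeasZ.
have -> : \int[P]_w g1 (x, V i w, z, t) = \int[P]_w (F x (V i w) ^+ 2 +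
    (3%:R * V i w ^+ 3 - 3%:R * V i w ^+ 6 + V i w ^+ 9) - (x / 3%:R + 3%:R / 4%:R)).
  by apply: eq_Rintegral => w _; rewrite /g1/= clV clE//; field.
rewrite (meanB P (bmeasD b1 b2) (bmeas_cst _ _)) (meanD P b1 b2) mean_cst EF1//.
rewrite (meanD P (bmeasB (bmeasZ _ (b3 3%N)) (bmeasZ _ (b3 6%N))) (b3 9%N)).
rewrite (meanB P (bmeasZ _ (b3 3%N)) (bmeasZ _ (b3 6%N))).
rewrite (meanZ P _ (b3 3%N)) (meanZ P _ (b3 6%N)) !Epow.
by field.
Qed.

Let g2_canonical1 i y z t : unit_itv y -> unit_itv z -> unit_itv t ->
  \int[P]_w g2 (V i w, y, z, t) = 0.
Proof.
move=> uy uz _; rewrite /g2/=.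
have b1 : bmeas (fun w => F z y * b (V i w) z y) by exact: bmeasZ.
have b2 : bmeas (fun w => F z y * b (V i w) z y - F z y ^+ 2).
  by apply: bmeasB => //; exact: bmeas_cst.
rewrite (meanB P b2 (bmeasZ _ (bqV i))) (meanB P b1 (bmeas_cst _ _)) mean_cst.
rewrite (meanZ P _ (bbV i z y)) (meanZ P _ (bqV i)) Eb// Eq.
by ring.
Qed.

Let g2_canonical2 i x z t : unit_itv x -> unit_itv z -> unit_itv t ->
  \int[P]_w g2 (x, V i w, z, t) = 0.
Proof.
move=> ux uz _; rewrite /g2/=.
have b1 : bmeas (fun w => F z (V i w) * b x z (V i w)).
  by apply: bmeasM => //; exact: bb.
have b2 : bmeas (fun w => F z (V i w) ^+ 2) by exact: bmeasX.
rewrite (meanB P (bmeasB b1 b2) (bmeas_cst _ _)) (meanB P b1 b2) mean_cst.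
by rewrite EFb// EF1// /q !clE//; field.
Qed.

Let g3_canonical1 i y z t : unit_itv y -> unit_itv z -> unit_itv t ->
  \int[P]_w g3 (V i w, y, z, t) = 0.
Proof. by move=> _ _ _; rewrite /g3/= (meanZ P _ (bqV i)) Eq mulr0. Qed.

Let g3_canonical2 i x z t : unit_itv x -> unit_itv z -> unit_itv t ->
  \int[P]_w g3 (x, V i w, z, t) = 0.
Proof.
move=> _ _ _; have b1 := bmeasX 1 (bV i).
have -> : \int[P]_w g3 (x, V i w, z, t) =
    \int[P]_w (q x * (V i w ^+ 1 - 3%:R / 4%:R)).
  by apply: eq_Rintegral => w _; rewrite /g3/= clV expr1 mulrC.
rewrite (meanZ P _ (bmeasB b1 (bmeas_cst _ _))) (meanB P b1 (bmeas_cst _ _)).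
by rewrite Epow mean_cst subrr mulr0.
Qed.

Let g4_canonical1 i y z t : unit_itv y -> unit_itv z -> unit_itv t ->
  \int[P]_w g4 (V i w, y, z, t) = 0.
Proof.
move=> _ uz ut.
have -> : \int[P]_w g4 (V i w, y, z, t) =
    \int[P]_w ((b y z t - F z t) * (b (V i w) z t - F z t)).
  by apply: eq_Rintegral => w _; rewrite /g4/= mulrC.
rewrite (meanZ P _ (bmeasB (bbV i z t) (bmeas_cst _ _))).
by rewrite (meanB P (bbV i z t) (bmeas_cst _ _)) mean_cst Eb// subrr mulr0.
Qed.

Let g4_canonical2 i x z t : unit_itv x -> unit_itv z -> unit_itv t ->
  \int[P]_w g4 (x, V i w, z, t) = 0.
Proof.
move=> _ uz ut; rewrite /g4/=.
rewrite (meanZ P _ (bmeasB (bbV i z t) (bmeas_cst _ _))).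
by rewrite (meanB P (bbV i z t) (bmeas_cst _ _)) mean_cst Eb// subrr mulr0.
Qed.

(** The expansion of 1/2 - x / 3 - (1 - x^3)^3 - (3/2) q(x): the two conditional expectations of
    F^2, and q with the weight 2 * 3/4 of the doubled cross term. *)
Definition projection (x : R) : R :=
  - (x / 3%:R) + 3%:R / 2%:R * x ^+ 3 - 9%:R / 4%:R * x ^+ 6 + x ^+ 9.

Let beq i j : bmeas (fun w => (V i w == V j w)%:R : R).
Proof.
have -> : (fun w => (V i w == V j w)%:R : R) =
    (fun w => 1 - (V i w < V j w)%R%:R - (V j w < V i w)%R%:R).
  by apply/funext => w; case: ltgtP => _; rewrite /= ?subr0 ?subrr.
apply: bmeasB; last exact: bmeas_lt.
by apply: bmeasB; [exact: bmeas_cst|exact: bmeas_lt].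
Qed.

(** Off the diagonal a tie has probability 0, because V i has no atoms once V j is frozen; the n
    diagonal pairs out of n^2 give 1 / n. *)
Lemma mean_tie_rate n : (0 < n)%N ->
  \int[P]_w tie_rate n (fun i => V i w) <= 1 / n%:R.
Proof.
move=> n0; have nR : 0 < n%:R :> R by rewrite ltr0n.
have E i j : \int[P]_w (V i w == V j w)%:R = (i == j)%:R :> R.
  have [->|ij] := eqVneq i j.
    by under eq_Rintegral do rewrite eqxx; rewrite mean_cst.
  pose f (p : R * rest_type V i) : R := (p.1 == V j p.2)%:R.
  have mVj : measurable_fun setT (fun p : R * rest_type V i => V j p.2).
    apply: (@measurableT_comp _ _ _ _ _ _ (V j : rest_type V i -> R)).
      by apply: measurable_rest; rewrite eq_sym.
    exact: measurable_snd.
  have bf : bmeas f.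
    have -> : f = (fun p => 1 - (p.1 < V j p.2)%R%:R - (V j p.2 < p.1)%R%:R).
      by apply/funext => w; rewrite /f; case: ltgtP => _; rewrite /= ?subr0 ?subrr.
    apply: bmeasB; last exact: bmeas_lt.
    by apply: bmeasB; [exact: bmeas_cst|exact: bmeas_lt].
  rewrite (mean_rest mV indep_root_exp bf) -[RHS](mean_cst P).
  apply: eq_Rintegral => w _; rewrite /f/=.
  exact: (mean_root_exp_eq lambda0 (lawX i)).
have e1 : \int[P]_w tie_rate n (fun i => V i w) =
    avg n (fun i => \int[P]_w avg n (fun j => (V i w == V j w)%:R)).
  by apply: mean_avg => i; exact: bmeas_avg.
have e2 i : (i < n)%N -> \int[P]_w avg n (fun j => (V i w == V j w)%:R) = n%:R^-1.
  move=> ni; rewrite (mean_avg P n (beq i)) /avg (bigD1 (Ordinal ni))//= E eqxx.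
  rewrite big1 ?addr0 ?mulr1// => j; rewrite -val_eqE/= eq_sym E.
  by move/negPf => ->.
by rewrite e1 (eq_avg_lt e2) avg_cst// div1r.
Qed.

Lemma mean_remainder : exists2 C, 0 <= C & forall n, (0 < n)%N ->
  \int[P]_w `|smin_rate n (fun i => V i w) - beat_rate n (fun i => V i w) -
    avg n (fun i => projection (V i w))| <= C / n%:R.
Proof.
have [C1 C10 H1] := canonical_mean_abs bg1 g1_canonical1 g1_canonical2.
have [C2 C20 H2] := canonical_mean_abs bg2 g2_canonical1 g2_canonical2.
have [C3 C30 H3] := canonical_mean_abs bg3 g3_canonical1 g3_canonical2.
have [C4 C40 H4] := canonical_mean_abs bg4 g4_canonical1 g4_canonical2.
exists (3%:R / 2%:R + C1 + 2%:R * C2 + 2%:R * C3 + C4).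
  by rewrite !addr_ge0// ?mulr_ge0 ?divr_ge0.
move=> n n0.
have btie : bmeas (fun w => tie_rate n (fun i => V i w)).
  by do 2 (apply: bmeas_avg => ?).
have bbeat := bmeas_beat_rate n bV.
have bsmin := bmeas_smin_rate n bV.
have bproj : bmeas (fun w => avg n (fun i => projection (V i w))).
  apply: bmeas_avg => i; apply: bmeasD; last exact: bmeasX.
  apply: bmeasB; last by apply: bmeasZ; exact: bmeasX.
  apply: bmeasD; last by apply: bmeasZ; exact: bmeasX.
  by apply: bmeasN; apply: bmeasM => //; exact: bmeas_cst.
(* U^2 = (U - F)^2 + 2 (F U - F^2) + F^2, where F U - F^2 averages to [g2] plus v_k Q, v_k Q to [g3]
   plus (3/4) Q, and F^2 to [g1] plus v_k / 3 + (1 - v_l^3)^3 - 1/4. *)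
have decomp w : beat_rate n (fun i => V i w) =
    avgV4 g4 n w + 2%:R * avgV4 g2 n w + 2%:R * avgV4 g3 n w + avgV4 g1 n w +
    (1 / 4%:R - avg n (fun i => projection (V i w))).
  pose v i := V i w.
  pose f c e := F (V c w) (V e w); pose u i k l := b (V i w) (V k w) (V l w).
  have -> : beat_rate n v = avg n (fun k => avg n (fun l => avg n (fun i => avg n (fun j =>
      u i k l * u j k l)))).
    by do 4 (apply: eq_avg => ?); rewrite /u /b !clV.
  have -> : avgV4 g4 n w = avg n (fun k => avg n (fun l => avg n (fun i => avg n (fun j =>
      (u i k l - f k l) * (u j k l - f k l))))) by [].
  (* In [g2] the index j occupies the slot of e; it is renamed l to match the other terms. *)
  have -> : avgV4 g2 n w = avg n (fun k => avg n (fun l => avg n (fun i =>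
      f k l * u i k l - f k l ^+ 2 - v k * q (v i)))).
    rewrite /g2/=; apply: eq_avg => k; rewrite avg_cst// avg_swap; apply: eq_avg => l.
    by apply: eq_avg => i; rewrite clV.
  have -> : avgV4 g3 n w = avg n (fun k => avg n (fun i => (v k - 3%:R / 4%:R) * q (v i))).
    rewrite /g3/= !avg_cst// avg_swap; apply: eq_avg => k; apply: eq_avg => i.
    by rewrite clV.
  have -> : avgV4 g1 n w = avg n (fun k => avg n (fun l =>
      f k l ^+ 2 - v k / 3%:R - (1 - v l ^+ 3) ^+ 3 + 4%:R^-1)).
    rewrite /g1/= !avg_cst//; apply: eq_avg => k; apply: eq_avg => l.
    by rewrite !clV.
  pose Q := avg n (fun i => q (v i)); pose U k l := avg n (fun i => u i k l).
  pose B l := (1 - v l ^+ 3) ^+ 3.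
  (* Every term, the projection included, becomes an average over (k, l) with Q constant, so that
     the identity can be checked for each pair. *)
  pose M2 (h : nat -> nat -> R) := avg n (fun k => avg n (fun l => h k l)).
  have M2D h1 h2 : M2 (fun k l => h1 k l + h2 k l) = M2 h1 + M2 h2.
    by rewrite /M2 -avgD; apply: eq_avg => k; rewrite -avgD.
  have M2Z r h : M2 (fun k l => r * h k l) = r * M2 h.
    by rewrite /M2 -avgZ; apply: eq_avg => k; rewrite -avgZ.
  have M2c r : M2 (fun _ _ => r) = r by rewrite /M2 !avg_cst.
  have -> : avg n (fun k => avg n (fun l => avg n (fun i => avg n (fun j => u i k l * u j k l)))) =
      M2 (fun k l => U k l ^+ 2).
    apply: eq_avg => k; apply: eq_avg => l; rewrite expr2 {1}/U mulrC -avgZ.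
    by apply: eq_avg => i; rewrite mulrC -avgZ.
  have -> : avg n (fun k => avg n (fun l => avg n (fun i => avg n (fun j =>
      (u i k l - f k l) * (u j k l - f k l))))) = M2 (fun k l => (U k l - f k l) ^+ 2).
    apply: eq_avg => k; apply: eq_avg => l.
    have -> : U k l - f k l = avg n (fun i => u i k l - f k l) by rewrite avgB avg_cst.
    rewrite expr2 mulrC -avgZ.
    by apply: eq_avg => i; rewrite mulrC -avgZ.
  have -> : avg n (fun k => avg n (fun l => avg n (fun i =>
      f k l * u i k l - f k l ^+ 2 - v k * q (v i)))) =
      M2 (fun k l => f k l * U k l - f k l ^+ 2 - v k * Q).
    apply: eq_avg => k; apply: eq_avg => l.
    by rewrite !avgB !avgZ avg_cst.
  have -> : avg n (fun k => avg n (fun i => (v k - 3%:R / 4%:R) * q (v i))) =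
      M2 (fun k l => (v k - 3%:R / 4%:R) * Q).
    by apply: eq_avg => k; rewrite avgZ avg_cst.
  have -> : avg n (fun i => projection (v i)) =
      M2 (fun k l => 2%:R^-1 - v k / 3%:R - B l - 3%:R / 2%:R * Q).
    transitivity (avg n (fun i => 2%:R^-1 - v i / 3%:R - B i - 3%:R / 2%:R * q (v i))).
      by apply: eq_avg => i; rewrite /projection /B /q /v clV; field.
    have -> : M2 (fun k l => 2%:R^-1 - v k / 3%:R - B l - 3%:R / 2%:R * Q) =
        avg n (fun k => 2%:R^-1 - v k / 3%:R - avg n B - 3%:R / 2%:R * Q).
      by apply: eq_avg => k; rewrite !avgB !avg_cst//.
    by rewrite !avgB avgZ !avg_cst//.
  rewrite -[1 / 4%:R in RHS]M2c -/(M2 _) -!M2Z.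
  have M2N h : - M2 h = M2 (fun k l => - h k l).
    by rewrite -mulN1r -M2Z; do 2 (apply: eq_avg => ?); rewrite mulN1r.
  rewrite M2N -!M2D; do 2 (apply: eq_avg => ?).
  by rewrite /B; field.
pose r w := 3%:R / 2%:R * tie_rate n (fun i => V i w) + `|avgV4 g1 n w| +
  2%:R * `|avgV4 g2 n w| + 2%:R * `|avgV4 g3 n w| + `|avgV4 g4 n w|.
have b0 := bmeasZ (3%:R / 2%:R) btie.
have b1 := bmeas_norm (bavg4 n bg1).
have b2 := bmeasZ 2%:R (bmeas_norm (bavg4 n bg2)).
have b3 := bmeasZ 2%:R (bmeas_norm (bavg4 n bg3)).
have b4 := bmeas_norm (bavg4 n bg4).
have b01 := bmeasD b0 b1; have b012 := bmeasD b01 b2; have b0123 := bmeasD b012 b3.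
apply: (@le_trans _ _ (\int[P]_w r w)).
  apply: le_mean.
  - by apply: bmeas_norm; apply: bmeasB => //; exact: bmeasB.
  - exact: bmeasD.
  move=> w; rewrite decomp /r.
  have := smin_rate_bound n0 (fun i => V i w).
  rewrite !ler_norml.
  move: (smin_rate _ _) (tie_rate _ _) (avg n (fun i => projection (V i w))) => s t p.
  move: (avgV4 g1 n w) (avgV4 g2 n w) (avgV4 g3 n w) (avgV4 g4 n w) => x1 x2 x3 x4.
  have := ler_norm x1; have := ler_norm (- x1); rewrite normrN.
  have := ler_norm x2; have := ler_norm (- x2); rewrite normrN.
  have := ler_norm x3; have := ler_norm (- x3); rewrite normrN.
  have := ler_norm x4; have := ler_norm (- x4); rewrite normrN.
  by move=> *; apply/andP; split; lra.
rewrite /r (meanD P b0123 b4) (meanD P b012 b3) (meanD P b01 b2) (meanD P b0 b1).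
rewrite (meanZ P _ btie) (meanZ P _ (bmeas_norm (bavg4 n bg2))).
rewrite (meanZ P _ (bmeas_norm (bavg4 n bg3))).
have := mean_tie_rate n0; have := H1 n n0; have := H2 n n0; have := H3 n n0; have := H4 n n0.
rewrite !mulrDl mul1r -!(mulrA _ _ n%:R^-1).
by move=> *; lra.
Qed.

End remainder.

(** * From smooth test functions to distribution functions *)

Section portmanteau.
Context {R : realType}.

Lemma mean_set d (T : measurableType d) (P : probability T R) (p : T -> bool) :
  measurable [set x | p x] -> (\int[P]_x (p x)%:R)%:E = P [set x | p x].
Proof.
move=> mp; rewrite /Rintegral.
have -> : (\int[P]_x ((p x)%:R : R)%:E = P [set x | p x])%E.
  rewrite -[X in _ = P X]setIT -integral_indic//.
  by apply: eq_integral => x _; rewrite indicE mem_setE.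
by rewrite fineK// fin_num_measure.
Qed.

Lemma bmeas_le_cst d (T : measurableType d) (f : T -> R) (r : R) :
  measurable_fun setT f -> bmeas (fun x => (f x <= r)%R%:R : R).
Proof.
move=> mf; have -> : (fun x => (f x <= r)%R%:R : R) = (fun x => 1 - (r < f x)%R%:R).
  by apply/funext => x; case: ltP => _; rewrite ?subr0 ?subrr.
by apply: bmeasB; [exact: bmeas_cst|apply: bmeas_lt => //; exact: measurable_cst].
Qed.

Local Notation N s := (normal_prob 0 s : probability (measurableTypeR R) R).

(** The indicator of the half-line up to r lies between a spline descending on [r - k, r] and one
    descending on [r, r + k]. Their normal means lie between the distribution function at r - k and
    at r + k, which continuity at r makes close. *)
Lemma cvg_in_law_normal d (T : measurableType d) (P : probability T R)
    (Y : nat -> {RV P >-> R}) (sigma : R) :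
  (forall M h h1 h2, 0 <= M -> smooth3 M h h1 h2 ->
    (\int[P]_w h (Y n w)) @[n --> \oo] --> \int[N sigma]_z h z) ->
  cvg_in_law P Y (normal_prob 0 sigma).
Proof.
move=> H r cr.
pose p n := \int[P]_w (Y n w <= r)%R%:R.
pose Phi s := \int[N sigma]_z (z <= s)%R%:R.
have bY n s : bmeas (fun w => (Y n w <= s)%R%:R : R).
  by apply: bmeas_le_cst; exact: measurable_funPT.
have bN s : bmeas (fun z : measurableTypeR R => (z <= s)%R%:R : R) by exact: bmeas_le_cst.
have pE n : cdf (Y n) r = (p n)%:E.
  rewrite /p mean_set; last first.
    rewrite (_ : [set x | _] = Y n @^-1` `]-oo, r]); last first.
      by apply/seteqP; split=> w /=; rewrite in_itv.
    by rewrite -[X in measurable X]setTI; exact: measurable_funPT.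
  have <- : Y n @^-1` `]-oo, r]%classic = [set w | Y n w <= r].
    by apply/seteqP; split=> w /=; rewrite in_itv.
  by [].
have PhiE s : normal_prob 0 sigma `]-oo, s] = (Phi s)%:E.
  have sE : `]-oo, s]%classic = [set z : R | z <= s].
    by apply/seteqP; split=> z /=; rewrite in_itv.
  rewrite sE /Phi (mean_set (N sigma) (p := fun z => z <= s))//.
  by rewrite -sE; exact: measurable_itv.
suff cp : p n @[n --> \oo] --> Phi r.
  have : (p n)%:E @[n --> \oo] --> (Phi r)%:E by apply: cvg_EFin => //; exact: nearW.
  by rewrite -PhiE; under eq_fun do rewrite -pE.
have cPhi : Phi s @[s --> r] --> Phi r.
  have cr' : normal_prob 0 sigma `]-oo, s] @[s --> r] --> normal_prob 0 sigma `]-oo, r].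
    exact: cr.
  move: cr'; rewrite PhiE; under eq_fun do rewrite PhiE.
  exact: fine_cvg.
apply/cvgrPdist_le => /= e e0.
have e20 : 0 < e / 2%:R by rewrite divr_gt0.
have [k k0 kPhi] : exists2 k, 0 < k & `|Phi r - Phi (r + k)| <= e / 2%:R /\
    `|Phi r - Phi (r - k)| <= e / 2%:R.
  move/cvgrPdist_le : cPhi => /(_ _ e20)[k /= k0 Hk].
  exists (k / 2%:R); first by rewrite divr_gt0.
  by split; apply: Hk => /=; rewrite opprD ?opprK addrA subrr add0r ?normrN gtr0_norm;
    rewrite ?ltr_pdivrMr ?divr_gt0// ltr_pMr// ltr1n.
have [kU kL] := kPhi.
have [M [h [h1 [h2 [M0 hh h01 hl hr]]]]] := smooth_step r k0.
have [M' [g [g1 [g2 [M'0 gg g01 gl gr]]]]] := smooth_step (r - k) k0.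
have [bh _ _ _] := hh; have [bg _ _ _] := gg.
have /cvgrPdist_le/(_ _ e20) Hh := H _ _ _ _ M0 hh.
have /cvgrPdist_le/(_ _ e20) Hg := H _ _ _ _ M'0 gg.
have bhY n : bmeas (fun w => h (Y n w)).
  by apply: (bmeas_comp bh); exact: measurable_funPT.
have bgY n : bmeas (fun w => g (Y n w)).
  by apply: (bmeas_comp bg); exact: measurable_funPT.
have up n : p n <= \int[P]_w h (Y n w).
  apply: le_mean => // w; case: (leP (Y n w) r) => [yr|_]; first by rewrite hl.
  by have /andP[] := h01 (Y n w).
have lo n : \int[P]_w g (Y n w) <= p n.
  apply: le_mean => // w; case: (leP (Y n w) r) => [_|yr]; first by have /andP[] := g01 (Y n w).
  by rewrite gr// subrK ltW.
have upN : \int[N sigma]_z h z <= Phi (r + k).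
  apply: le_mean => // z; case: (leP z (r + k)) => [_|zr]; first by have /andP[] := h01 z.
  by rewrite hr// ltW.
have loN : Phi (r - k) <= \int[N sigma]_z g z.
  apply: le_mean => // z; case: (leP z (r - k)) => [zr|_]; first by rewrite gl.
  by have /andP[] := g01 z.
have conclude n : `|\int[N sigma]_z h z - \int[P]_w h (Y n w)| <= e / 2%:R ->
    `|\int[N sigma]_z g z - \int[P]_w g (Y n w)| <= e / 2%:R -> `|Phi r - p n| <= e.
  have := up n; have := lo n; move: upN loN kU kL; rewrite !ler_norml.
  move: (Rintegral _ _ _) (Rintegral _ _ _) (Rintegral _ _ _) (Rintegral _ _ _).
  move: (p n) (Phi r) (Phi (r + k)) (Phi (r - k)).
  by move=> p0 P0 P1 P2 I1 I2 I3 I4 ? ? /andP[? ?] /andP[? ?] ? ? /andP[? ?] /andP[? ?];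
    apply/andP; split; lra.
by near=> n; apply: conclude; near: n.
Unshelve. all: by end_near. Qed.

End portmanteau.

(** * Moments of the projection and the limit theorem *)

Section projection_moments.
Context d (T : measurableType d) (R : realType) (P : probability T R).
Variables (V : T -> R) (bV : bmeas V).
Hypothesis Epow : forall k, \int[P]_w V w ^+ k = 3%:R / k.+3%:R.

Let m (c : R) k := bmeasZ c (bmeasX k bV).

Let EZ (c : R) k : \int[P]_w (c * V w ^+ k) = c * (3%:R / k.+3%:R).
Proof. by rewrite (meanZ P _ (bmeasX k bV)) Epow. Qed.

Lemma mean_projection : \int[P]_w projection (V w) = 0.
Proof.
have -> : \int[P]_w projection (V w) = \int[P]_w (- 3%:R^-1 * V w ^+ 1 +
    3%:R / 2%:R * V w ^+ 3 + - (9%:R / 4%:R) * V w ^+ 6 + 1 * V w ^+ 9).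
  by apply: eq_Rintegral => w _; rewrite /projection; field.
have b2 := bmeasD (m (- 3%:R^-1) 1) (m (3%:R / 2%:R) 3).
have b3 := bmeasD b2 (m (- (9%:R / 4%:R)) 6).
rewrite (meanD P b3 (m 1 9)) (meanD P b2 (m (- (9%:R / 4%:R)) 6)).
rewrite (meanD P (m (- 3%:R^-1) 1) (m (3%:R / 2%:R) 3)) !EZ.
by field.
Qed.

Lemma variance_projection : \int[P]_w projection (V w) ^+ 2 = 23%:R / (10%:R * 1092%:R).
Proof.
have -> : \int[P]_w projection (V w) ^+ 2 = \int[P]_w (9%:R^-1 * V w ^+ 2 +
    - 1 * V w ^+ 4 + 9%:R / 4%:R * V w ^+ 6 + 3%:R / 2%:R * V w ^+ 7 +
    - (27%:R / 4%:R) * V w ^+ 9 + - (2%:R / 3%:R) * V w ^+ 10 +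
    129%:R / 16%:R * V w ^+ 12 + - (9%:R / 2%:R) * V w ^+ 15 + 1 * V w ^+ 18).
  by apply: eq_Rintegral => w _; rewrite /projection; field.
have b1 := m 9%:R^-1 2; have b2 := bmeasD b1 (m (- 1) 4).
have b3 := bmeasD b2 (m (9%:R / 4%:R) 6); have b4 := bmeasD b3 (m (3%:R / 2%:R) 7).
have b5 := bmeasD b4 (m (- (27%:R / 4%:R)) 9); have b6 := bmeasD b5 (m (- (2%:R / 3%:R)) 10).
have b7 := bmeasD b6 (m (129%:R / 16%:R) 12); have b8 := bmeasD b7 (m (- (9%:R / 2%:R)) 15).
rewrite (meanD P b8 (m 1 18)) (meanD P b7 (m (- (9%:R / 2%:R)) 15)).
rewrite (meanD P b6 (m (129%:R / 16%:R) 12)) (meanD P b5 (m (- (2%:R / 3%:R)) 10)).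
rewrite (meanD P b4 (m (- (27%:R / 4%:R)) 9)) (meanD P b3 (m (3%:R / 2%:R) 7)).
rewrite (meanD P b2 (m (9%:R / 4%:R) 6)) (meanD P b1 (m (- 1) 4)) !EZ.
by field.
Qed.

End projection_moments.

Lemma mean_lt0 (R : realType) d (T : measurableType d) (P : probability T R)
    (lambda : R) (X : {RV P >-> R}) : has_law P X (exponential_prob lambda) ->
  \int[P]_w (X w < 0)%R%:R = 0.
Proof.
move=> lawX; have mX : measurable_fun setT X by exact: measurable_funPT.
have E : [set w | X w < 0] = X @^-1` `]-oo, 0[.
  by apply/seteqP; split=> w /=; rewrite in_itv.
have mE : measurable [set w | X w < 0].
  by rewrite E -[X in measurable X]setTI; exact: mX.
apply/eqP; rewrite -eqe (mean_set P mE) E -[P _]/(distribution P X `]-oo, 0[%classic).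
rewrite lawX; last exact: measurable_itv.
rewrite /exponential_prob integral0_eq// => x /=; rewrite in_itv/= => x0.
by rewrite lt0_exponential_pdf.
Qed.

Lemma cvg_rate (R : realType) (u : nat -> R) (l A : R) : 0 <= A ->
  (forall n, (0 < n)%N -> `|u n - l| <= A * (Num.sqrt n%:R)^-1) ->
  u n @[n --> \oo] --> l.
Proof.
move=> A0 H; apply/cvgrPdist_le => /= e e0.
have key n : (0 < n)%N -> (A / e) ^+ 2 <= n%:R -> `|l - u n| <= e.
  move=> n0 nA; rewrite distrC; apply: le_trans (H n n0) _.
  have s0 : 0 < Num.sqrt n%:R :> R by rewrite sqrtr_gt0 ltr0n.
  rewrite ler_pdivrMr// -ler_pdivrMl// mulrC.
  rewrite -(ler_pXn2r (n := 2))// ?nnegrE ?divr_ge0 ?(ltW e0) ?(ltW s0)//.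
  by rewrite sqr_sqrtr.
near=> n; apply: key; first by near: n; exact: nbhs_infty_gt.
by near: n; exact: nbhs_infty_ger.
Unshelve. all: by end_near. Qed.

Theorem theorem1 (R : realType) (d : measure_display) (T : measurableType d)
    (P : probability T R) (lambda : R) (X : nat -> {RV P >-> R}) :
  0 < lambda ->
  independent_RVs P X ->
  (forall i, has_law P (X i) (exponential_prob lambda)) ->
  cvg_in_law P (fun n => sqrtn_Istat X n : {RV P >-> R})
    (normal_prob 0 (Num.sqrt (23%:R / (10%:R * 1092%:R)))).
Proof.
move=> lambda0 indepX lawX.
have : 0 < 23%:R / (10%:R * 1092%:R) :> R by lra.
move: (variance_projection (P := P)); move: (_ / _) => v Vproj vgt0.
have: Num.sqrt v ^+ 2 = v by rewrite sqr_sqrtr// ltW.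
have: 0 < Num.sqrt v by rewrite sqrtr_gt0.
move: (Num.sqrt v) => sigma sigma0 sigma2.
pose V i w := root_exp lambda (X i w).
have bV i : bmeas (V i) by exact: bmeas_root_exp.
have indepV := indep_root_exp lambda indepX.
have EV i k : \int[P]_w V i w ^+ k = 3%:R / k.+3%:R.
  exact: (mean_root_exp_pow lambda0 (lawX i)).
pose xi i w : R := projection (V i w).
have mproj : measurable_fun setT (@projection R).
  apply: measurable_funD; last exact: measurable_funX.
  apply: measurable_funB; last by apply: measurable_funM => //; exact: measurable_funX.
  apply: measurable_funD; last by apply: measurable_funM => //; exact: measurable_funX.
  by apply: measurableT_comp => //; exact: measurable_funM.
have mxi i : measurable_fun setT (xi i) by apply: measurableT_comp => //; exact: (bV i).1.
have indepxi (J : seq nat) (B : nat -> set R) : uniq J -> (forall i, measurable (B i)) ->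
    P (\bigcap_(i in [set` J]) (xi i @^-1` B i)) = (\prod_(i <- J) P (xi i @^-1` B i))%E.
  move=> uJ mB; apply: (indepV _ (fun i => @projection R @^-1` B i)) => // i.
  by rewrite -[X in measurable X]setTI; exact: mproj.
(* The absolute values of the coefficients, 1/3 + 3/2 + 9/4 + 1, sum to less than 6. *)
have xiB i w : `|xi i w| <= 6%:R.
  have v0 : 0 <= V i w by exact: expR_ge0.
  have v1 : V i w <= 1.
    by rewrite /V /root_exp -expR0 ler_expR mulNr oppr_le0 mulr_ge0// divr_ge0// ltW.
  have p k : 0 <= V i w ^+ k <= 1 by rewrite exprn_ge0// exprn_ile1.
  have := p 3; have := p 6; have := p 9; rewrite /xi /projection ler_norml.
  move: (V i w ^+ 3) (V i w ^+ 6) (V i w ^+ 9) => a b c /andP[? ?] /andP[? ?] /andP[? ?].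
  by apply/andP; split; lra.
have Exi i : \int[P]_w xi i w = 0 by exact: mean_projection.
have Vxi i : \int[P]_w xi i w ^+ 2 = sigma ^+ 2.
  by rewrite sigma2; exact: Vproj.
apply: cvg_in_law_normal => M h h1 h2 M0 hh.
have [L L0 hL] := smooth3_lipschitz M0 hh; have [bh _ _ _] := hh.
have [C C0 HC] := mean_remainder lambda0 indepX lawX.
pose J n w := smin_rate n (fun i => V i w) - beat_rate n (fun i => V i w).
pose K := M * (6%:R ^+ 3 + (1 + 32%:R * Num.sqrt 2%:R) * sigma ^+ 3).
have K0 : 0 <= K.
  by rewrite mulr_ge0// addr_ge0// mulr_ge0 ?addr_ge0 ?mulr_ge0 ?sqrtr_ge0 ?ler0n ?exprn_ge0// ltW.
apply: (@cvg_rate _ _ _ (L * C + K)); first by rewrite addr_ge0// mulr_ge0.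
move=> n n0.
have nR : 0 < n%:R :> R by rewrite ltr0n.
have q0 : 0 < Num.sqrt n%:R :> R by rewrite sqrtr_gt0.
have q2 : Num.sqrt n%:R ^+ 2 = n%:R :> R by rewrite sqr_sqrtr// ltW.
set q := Num.sqrt n%:R in q0 q2 *.
have bJ : bmeas (J n).
  by apply: bmeasB; [exact: (bmeas_smin_rate n bV)|exact: (bmeas_beat_rate n bV)].
have bS : bmeas (fun w => avg n (fun i => xi i w)).
  by apply: bmeas_avg => i; exact: bmeasP (xiB i).
have bhJ : bmeas (fun w => h (q * J n w)).
  by apply: (bmeas_comp bh); exact: (bmeasZ q bJ).1.
have bhS : bmeas (fun w => h (q * avg n (fun i => xi i w))).
  by apply: (bmeas_comp bh); exact: (bmeasZ q bS).1.
have bhY : bmeas (fun w => h (sqrtn_Istat X n w)).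
  by apply: (bmeas_comp bh); exact: measurable_sqrtn_Istat.
(* The two arguments agree when no observation is negative. Otherwise the difference is at most 2 A,
   hence at most 2 A times the number of negative observations, whose mean is 0. *)
have eY : \int[P]_w h (sqrtn_Istat X n w) = \int[P]_w h (q * J n w).
  have [_ [A hA]] := bh; have A0 : 0 <= A := le_trans (normr_ge0 _) (hA 0).
  have bneg i : bmeas (fun w => (X i w < 0)%R%:R : R).
    by apply: bmeas_lt; [exact: measurable_funPT|exact: measurable_cst].
  have bsum : bmeas (fun w => \sum_(i < n) ((X i w < 0)%R%:R : R)) by exact: bmeas_sum.
  apply/eqP; rewrite -subr_eq0 -(meanB P bhY bhJ) -normr_le0.
  apply: le_trans (norm_mean P (bmeasB bhY bhJ)) _.
  apply: (@le_trans _ _ (\int[P]_w (2%:R * A * \sum_(i < n) (X i w < 0)%R%:R))).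
    apply: le_mean.
    - by apply: bmeas_norm; exact: bmeasB.
    - exact: bmeasZ.
    move=> w; have [i Xi|Xpos] := pickP (fun i : 'I_n => X i w < 0).
      apply: (@le_trans _ _ (2%:R * A * 1)).
        rewrite mulr1 mulr_natl mulr2n; apply: le_trans (ler_normB _ _) _.
        exact: lerD.
      apply: ler_wpM2l; first exact: mulr_ge0.
      by rewrite (bigD1 i)//= Xi lerDl sumr_ge0.
    rewrite big1 ?mulr0; last by move=> i _; rewrite Xpos.
    rewrite /sqrtn_Istat (Istat_root_exp lambda0 n0) ?subrr ?normr0//.
    by move=> i ni; have := Xpos (Ordinal ni); rewrite ltNge => /negbFE.
  rewrite (meanZ P _ bsum) mean_sum// big1 ?mulr0// => i _.
  exact: mean_lt0 (lawX i).
(* The Lipschitz bound costs L q times a mean remainder C / n, and n = q^2. *)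
have eJ : `|\int[P]_w h (q * J n w) - \int[P]_w h (q * avg n (fun i => xi i w))| <= L * C * q^-1.
  rewrite -(meanB P bhJ bhS).
  apply: le_trans (norm_mean P (bmeasB bhJ bhS)) _.
  have bD := bmeas_norm (bmeasB bJ bS).
  apply: (@le_trans _ _ (\int[P]_w (L * q * `|J n w - avg n (fun i => xi i w)|))).
    apply: le_mean.
    - by apply: bmeas_norm; exact: bmeasB.
    - exact: bmeasZ.
    move=> w; have -> : q * J n w = q * avg n (fun i => xi i w) +
        q * (J n w - avg n (fun i => xi i w)) by ring.
    by apply: le_trans (hL _ _) _; rewrite normrM (gtr0_norm q0) mulrA.
  rewrite (meanZ P _ bD); apply: (@le_trans _ _ (L * q * (C / n%:R))).
    by apply: ler_wpM2l; [rewrite mulr_ge0// ltW|exact: HC].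
  by rewrite -q2 le_eqVlt; apply/orP; left; apply/eqP; field; rewrite gt_eqF.
have eS := lindeberg_mean mxi indepxi sigma0 xiB Exi Vxi n0 M0 hh.
rewrite eY mulrDl; apply: le_trans (lerD eJ eS).
by apply: le_trans (ler_normD _ _); rewrite addrA subrK.
Qed.
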